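(* Let $\Delta t>0$ and let $(f^n,\mathbf E^n)_{n\ge 0}$ be a sequence produced by one of the three time discretizations $\textbf{Scheme-1}(\Delta t)$, $\textbf{Scheme-2}(\Delta t)$, $\textbf{Scheme-3}(\Delta t)$ of the Vlasov–Ampère system (defined in the context), under periodic boundary conditions in $\mathbf x$ and vanishing boundary conditions in $\mathbf v$. Then the discrete total energy is preserved, $TE_n=TE_{n+1}$ for all $n$, where (i) for $\textbf{Scheme-1}(\Delta t)$ and $\textbf{Scheme-2}(\Delta t)$, $$2\,TE_n=\int_{\Omega_x}\int_{\Omega_v} f^n|\mathbf v|^2\,d\mathbf v\,d\mathbf x+\int_{\Omega_x}|\mathbf E^n|^2\,d\mathbf x;$$ (ii) for $\textbf{Scheme-3}(\Delta t)$, $$2\,TE_n=\int_{\Omega_x}\int_{\Omega_v} f^n|\mathbf v|^2\,d\mathbf v\,d\mathbf x+\int_{\Omega_x}\mathbf E^{n+1/2}\cdot\mathbf E^{n-1/2}\,d\mathbf x=\int_{\Omega_x}\int_{\Omega_v} f^n|\mathbf v|^2\,d\mathbf v\,d\mathbf x+\int_{\Omega_x}|\mathbf E^n|^2\,d\mathbf x-\frac{\Delta t^2}{4}\int_{\Omega_x}|\mathbf J^n|^2\,d\mathbf x.$$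
   Context: The Vlasov–Ampère system is $\partial_t f+\mathbf v\cdot\nabla_{\mathbf x}f+\mathbf E\cdot\nabla_{\mathbf v}f=0$, $\partial_t\mathbf E=-\mathbf J$, with $\mathbf J(\mathbf x,t)=\int_{\Omega_v}f\,\mathbf v\,d\mathbf v$, on $\Omega_x\times\Omega_v$ (both of the same dimension). Here $f=f(\mathbf x,\mathbf v,t)$ is scalar and $\mathbf E=\mathbf E(\mathbf x,t)$ is vector valued. Only time is discretized; $(\mathbf x,\mathbf v)$ remain continuous, so $f^n=f^n(\mathbf x,\mathbf v)$, $\mathbf E^n=\mathbf E^n(\mathbf x)$, and similarly with index $n+1/2$. Write $\mathbf J^{m}=\int_{\Omega_v}f^{m}\mathbf v\,d\mathbf v$ for $m=n,n+1/2,n+1$. Boundary conditions: $\Omega_x$ is a finite (periodic) box and all functions are periodic in $\mathbf x$; either $\Omega_v$ is a bounded domain and all approximations of $f$ vanish on $\partial\Omega_v$, or $\Omega_v$ is the whole space and they tend to $0$ as $|\mathbf v|\to\infty$. All functions are smooth enough, and decay fast enough in $\mathbf v$, for the integrals below to be finite and for integration by parts to be valid without boundary terms. $\textbf{Scheme-1}(\Delta t)$ (explicit): $(f^n,\mathbf E^n)\mapsto(f^{n+1},\mathbf E^{n+1})$ with $$\frac{f^{n+1/2}-f^n}{\Delta t/2}+\mathbf v\cdot\nabla_{\mathbf x}f^n+\mathbf E^n\cdot\nabla_{\mathbf v}f^n=0,\qquad \frac{\mathbf E^{n+1}-\mathbf E^n}{\Delta t}=-\mathbf J^{n+1/2},$$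 $$\frac{f^{n+1}-f^n}{\Delta t}+\mathbf v\cdot\nabla_{\mathbf x}f^{n+1/2}+\tfrac12(\mathbf E^n+\mathbf E^{n+1})\cdot\nabla_{\mathbf v}f^{n+1/2}=0.$$ $\textbf{Scheme-2}(\Delta t)$ (implicit midpoint): $$\frac{f^{n+1}-f^n}{\Delta t}+\mathbf v\cdot\nabla_{\mathbf x}\frac{f^n+f^{n+1}}2+\tfrac12(\mathbf E^n+\mathbf E^{n+1})\cdot\nabla_{\mathbf v}\frac{f^n+f^{n+1}}2=0,\qquad \frac{\mathbf E^{n+1}-\mathbf E^n}{\Delta t}=-\tfrac12(\mathbf J^n+\mathbf J^{n+1}).$$ $\textbf{Scheme-3}(\Delta t)$ (implicit, Strang splitting): $$\frac{\mathbf E^{n+1/2}-\mathbf E^n}{\Delta t/2}=-\mathbf J^n,\quad \frac{f^{n+1}-f^n}{\Delta t}+\mathbf v\cdot\nabla_{\mathbf x}\frac{f^n+f^{n+1}}2+\mathbf E^{n+1/2}\cdot\nabla_{\mathbf v}\frac{f^n+f^{n+1}}2=0,\quad \frac{\mathbf E^{n+1}-\mathbf E^{n+1/2}}{\Delta t/2}=-\mathbf J^{n+1}.$$ For Scheme-3, $\mathbf E^{n-1/2}$ is the intermediate field of the preceding step, so $\mathbf E^{n-1/2}=\mathbf E^n+\frac{\Delta t}2\mathbf J^n$; for $n=0$ this formula is taken as the definition. For the implicit schemes, the sequence is any sequence satisfying the scheme. *)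

(* Defs.v *)
From HB Require Import structures.
From mathcomp Require Import all_boot all_order all_algebra.
From mathcomp Require Import all_classical all_reals all_analysis.

Set Implicit Arguments.
Unset Strict Implicit.
Unset Printing Implicit Defensive.

Import Order.TTheory GRing.Theory Num.Theory.
Import numFieldNormedType.Exports.

Local Open Scope classical_set_scope.
Local Open Scope ring_scope.

(** * Lebesgue measure on ['rV[R]_d]

    The library has Lebesgue measure on [R] and binary product measures only.
    ['rV[R]_d] receives the sigma-algebra generated by the coordinates (the
    Borel one), and the measure is the [d]-fold product of the
    one-dimensional Lebesgue measure, transported along
    [(t, y) |-> (t, y_0, y_1, ...)]. *)

Section rV_measurable.
Context {R : realType} (d : nat).

Definition rV_coord (i : 'I_d) (x : 'rV[R]_d) : R := x 0 i.

Let rV0 : g_sigma_preimage rV_coord set0.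
Proof. exact: sigma_algebra0. Qed.

Let rVC A : g_sigma_preimage rV_coord A -> g_sigma_preimage rV_coord (~` A).
Proof. exact: sigma_algebraC. Qed.

Let rVU (F : (set 'rV[R]_d)^nat) :
  (forall i, g_sigma_preimage rV_coord (F i)) ->
  g_sigma_preimage rV_coord (\bigcup_i F i).
Proof. exact: sigma_algebra_bigcup. Qed.

HB.instance Definition _ := @isMeasurable.Build default_measure_display
  'rV[R]_d (g_sigma_preimage rV_coord) rV0 rVC rVU.

Lemma measurable_rV_coord (i : 'I_d) : measurable_fun setT (rV_coord i).
Proof.
move=> _ Y mY; rewrite setTI; apply: sub_sigma_algebra => /=.
rewrite -bigcup_seq/=; exists i => /=; first by rewrite mem_index_enum.
by exists Y => //; rewrite setTI.
Qed.

Lemma measurable_fun_rVP d1 (T : measurableType d1) (f : T -> 'rV[R]_d) :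
  (forall i, measurable_fun setT (rV_coord i \o f)) -> measurable_fun setT f.
Proof.
move=> mf _ A mA; rewrite setTI.
suff : g_sigma_preimage rV_coord `<=` [set B | measurable (f @^-1` B)].
  exact.
apply: smallest_sub.
  split => /=.
  - by rewrite preimage_set0.
  - move=> B mB; rewrite setTD preimage_setC; exact: measurableC.
  - by move=> F mF; rewrite preimage_bigcup; exact: bigcupT_measurable.
rewrite -bigcup_seq => B [i _ [C mC <-]] /=.
by have := mf i measurableT C mC; rewrite !setTI -comp_preimage.
Qed.

End rV_measurable.

Definition rV_cons {R : realType} {d : nat}
    (p : measurableTypeR R * 'rV[R]_d) : 'rV[R]_d.+1 :=
  \row_i if unlift ord0 i is Some j then p.2 0 j else p.1.

Lemma measurable_rV_cons {R : realType} {d : nat} :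
  measurable_fun setT (@rV_cons R d).
Proof.
apply: measurable_fun_rVP => i.
case: (unliftP ord0 i) => [j ->|->].
  rewrite (_ : _ \o _ = @rV_coord R d j \o snd).
    exact: measurableT_comp (measurable_rV_coord j) measurable_snd.
  by apply/funext => p; rewrite /= /rV_coord /rV_cons mxE liftK.
rewrite (_ : _ \o _ = fst); first exact: measurable_fst.
by apply/funext => p; rewrite /= /rV_coord /rV_cons mxE unlift_none.
Qed.

Section lebesgue_cons.
Context {R : realType} {d : nat}.
Variable mu : {sigma_finite_measure set 'rV[R]_d -> \bar R}.

Definition lebesgue_cons : set 'rV[R]_d.+1 -> \bar R :=
  pushforward (lebesgue_measure \x mu)%E rV_cons.

Let lebesgue_cons0 : lebesgue_cons set0 = 0%E.
Proof. by rewrite /lebesgue_cons /pushforward preimage_set0 measure0. Qed.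

Let lebesgue_cons_ge0 A : (0 <= lebesgue_cons A)%E.
Proof. by rewrite /lebesgue_cons /pushforward measure_ge0. Qed.

Let lebesgue_cons_sigma_additive : semi_sigma_additive lebesgue_cons.
Proof.
move=> F mF tF mUF; rewrite /lebesgue_cons /pushforward preimage_bigcup.
apply: measure_semi_sigma_additive.
- by move=> n; rewrite -[X in measurable X]setTI; exact: measurable_rV_cons.
- apply/trivIsetP => /= i j _ _ ij; rewrite -preimage_setI.
  by move/trivIsetP : tF => /(_ _ _ _ _ ij) ->//; rewrite preimage_set0.
- rewrite -preimage_bigcup -[X in measurable X]setTI.
  exact: measurable_rV_cons.
Qed.

HB.instance Definition _ := isMeasure.Build _ _ _ lebesgue_cons
  lebesgue_cons0 lebesgue_cons_ge0 lebesgue_cons_sigma_additive.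

Let rV_head (x : 'rV[R]_d.+1) : measurableTypeR R := x 0 ord0.
Let rV_tail (x : 'rV[R]_d.+1) : 'rV[R]_d := \row_i x 0 (lift ord0 i).

Let measurable_uncons : measurable_fun setT (fun x => (rV_head x, rV_tail x)).
Proof.
apply: measurable_fun_pair; first exact: measurable_rV_coord.
apply: measurable_fun_rVP => i; rewrite (_ : _ \o _ = rV_coord (lift ord0 i)).
  exact: measurable_rV_coord.
by apply/funext => x; rewrite /= /rV_coord mxE.
Qed.

Let rV_consK : cancel rV_cons (fun x => (rV_head x, rV_tail x)).
Proof.
move=> [t y]; congr pair; rewrite /rV_head /rV_tail /rV_cons /=.
  by rewrite mxE unlift_none.
by apply/rowP => i; rewrite !mxE liftK.
Qed.

(* The library's sigma-finite instance of a binary product is shadowed by the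
   one for subprobabilities. *)
Let product_sigma_finite : sigma_finite setT (@lebesgue_measure R \x mu)%E.
Proof.
have /sigma_finiteP[F [TF ndF Foo]] := sigma_finiteT (@lebesgue_measure R).
have /sigma_finiteP[G [TG ndG Goo]] := sigma_finiteT mu.
exists (fun n => F n `*` G n).
  rewrite -setXTT TF TG predeqE => -[x y]; split.
    move=> [/= [n _ Fnx] [k _ Gky]]; exists (maxn n k) => //; split.
    - by move: x Fnx; exact/subsetPset/ndF/leq_maxl.
    - by move: y Gky; exact/subsetPset/ndG/leq_maxr.
  by move=> [n _ []/= ? ?]; split; exists n.
move=> k; have [? ?] := Foo k; have [? ?] := Goo k.
split; first exact: measurableX.
by rewrite product_measure1E// lte_mul_pinfty// ge0_fin_numE.
Qed.

Let lebesgue_cons_sigma_finite : sigma_finite setT lebesgue_cons.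
Proof.
have [F FT mF] := product_sigma_finite.
exists (fun n => (fun x => (rV_head x, rV_tail x)) @^-1` F n).
  by rewrite -preimage_bigcup -FT preimage_setT.
move=> n; have [mFn Fnoo] := mF n; split.
  by rewrite -[X in measurable X]setTI; exact: measurable_uncons.
rewrite /lebesgue_cons /pushforward -comp_preimage.
by rewrite (_ : _ \o _ = id) //; exact/funext/rV_consK.
Qed.

HB.instance Definition _ := @Measure_isSigmaFinite.Build _ _ _ lebesgue_cons
  lebesgue_cons_sigma_finite.

End lebesgue_cons.

Fixpoint lebesgue_rV {R : realType} (d : nat) :
    {sigma_finite_measure set 'rV[R]_d -> \bar R} :=
  if d is d'.+1 then lebesgue_cons (lebesgue_rV d') else \d_(0 : 'rV[R]_0).

(** * Vector calculus *)

(* The norm [`|_|] of ['rV[R]_d] is the sup norm; the Euclidean square of [v]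
   is [dotp v v]. *)
Definition dotp {R : realType} {d : nat} (u v : 'rV[R]_d) : R :=
  \sum_(i < d) u 0 i * v 0 i.

Definition gradient {R : realType} {d : nat} (g : 'rV[R]_d -> R)
    (x : 'rV[R]_d) : 'rV[R]_d :=
  \row_i 'D_(delta_mx 0 i) g x.

Definition C1_on {R : realType} {V : normedModType R} (U : set V)
    (g : V -> R) : Prop :=
  forall z, U z ->
    differentiable g z /\ forall w, {for z, continuous (fun y => 'D_w g y)}.

Definition box {R : realType} {d : nat} (a b : 'rV[R]_d) : set 'rV[R]_d :=
  [set x | forall i, a 0 i <= x 0 i <= b 0 i].

(* Functions on the periodic box are represented by their periodic extensions
   to the whole space. *)
Definition box_periodic {R : realType} {d : nat} {T : Type} (a b : 'rV[R]_d)
    (g : 'rV[R]_d -> T) : Prop :=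
  forall x i, g (x + (b 0 i - a 0 i) *: delta_mx 0 i) = g x.

(** * The Vlasov-Ampere system *)

Section vlasov_ampere.
Context {R : realType} {d : nat}.
Implicit Types (f : 'rV[R]_d -> 'rV[R]_d -> R) (E : 'rV[R]_d -> 'rV[R]_d).

Definition velocity_domain (Ov : set 'rV[R]_d) : Prop :=
  [/\ Ov !=set0, open Ov, connected Ov & bounded_set Ov] \/ Ov = setT.

Definition vanishing_in_v (Ov : set 'rV[R]_d) f : Prop :=
  (bounded_set Ov -> forall x v, closure Ov v -> ~ Ov v -> f x v = 0) /\
  (Ov = setT -> forall x (e : R), 0 < e ->
    exists M : R, forall v, M < `|v| -> `|f x v| < e).

Definition grad_x f (x v : 'rV[R]_d) : 'rV[R]_d := gradient (f^~ v) x.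
Definition grad_v f (x v : 'rV[R]_d) : 'rV[R]_d := gradient (f x) v.

Definition favg f g : 'rV[R]_d -> 'rV[R]_d -> R :=
  fun x v => (f x v + g x v) / 2.
Definition Eavg (E F : 'rV[R]_d -> 'rV[R]_d) : 'rV[R]_d -> 'rV[R]_d :=
  fun x => 2^-1 *: (E x + F x).

Definition phase_integrable (a b : 'rV[R]_d) (Ov : set 'rV[R]_d)
    (g : 'rV[R]_d -> 'rV[R]_d -> R) : Prop :=
  (lebesgue_rV d \x lebesgue_rV d)%E.-integrable (box a b `*` Ov)
    (fun z => (g z.1 z.2)%:E).

(* "Decays fast enough in v" is expressed by finiteness of the integrals that
   multiplying the schemes by |v|^2 produces; no integration by parts formula
   is assumed. Values of [f x v] for [v] outside the closure of [Ov] are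
   irrelevant. *)
Record admissible_f (a b : 'rV[R]_d) (Ov : set 'rV[R]_d) f : Prop := {
  f_periodic : box_periodic a b f ;
  f_vanishing : vanishing_in_v Ov f ;
  f_C1 : C1_on (setT `*` Ov) (fun z => f z.1 z.2) ;
  f_continuous : {within setT `*` closure Ov, continuous (fun z => f z.1 z.2)} ;
  f_current : forall x i,
    (lebesgue_rV d).-integrable Ov (fun v => (f x v * v 0 i)%:E) ;
  f_momentum : forall i, phase_integrable a b Ov (fun x v => f x v * v 0 i) ;
  f_energy : phase_integrable a b Ov (fun x v => f x v * dotp v v) ;
  f_grad_x : phase_integrable a b Ov
    (fun x v => dotp v (grad_x f x v) * dotp v v) ;
  f_grad_v : forall i, phase_integrable a b Ov
    (fun x v => grad_v f x v 0 i * dotp v v) }.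

Definition admissible_E (a b : 'rV[R]_d) E : Prop :=
  box_periodic a b E /\ continuous E.

Definition current (Ov : set 'rV[R]_d) f : 'rV[R]_d -> 'rV[R]_d :=
  fun x => \row_i \int[lebesgue_rV d]_(v in Ov) (f x v * v 0 i).

(* [fn], [En] (resp. [fh], [Eh] and [fn1], [En1]) are the approximations at
   step n (resp. n + 1/2 and n + 1). *)

Definition scheme1 (dt : R) (Ov : set 'rV[R]_d) fn En fh fn1 En1 : Prop :=
  [/\ forall x v, Ov v ->
        (fh x v - fn x v) / (dt / 2) + dotp v (grad_x fn x v)
          + dotp (En x) (grad_v fn x v) = 0,
      forall x, dt^-1 *: (En1 x - En x) = - current Ov fh x
    & forall x v, Ov v ->
        (fn1 x v - fn x v) / dt + dotp v (grad_x fh x v)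
          + dotp (Eavg En En1 x) (grad_v fh x v) = 0].

Definition scheme2 (dt : R) (Ov : set 'rV[R]_d) fn En fn1 En1 : Prop :=
  (forall x v, Ov v ->
     (fn1 x v - fn x v) / dt + dotp v (grad_x (favg fn fn1) x v)
       + dotp (Eavg En En1 x) (grad_v (favg fn fn1) x v) = 0) /\
  (forall x, dt^-1 *: (En1 x - En x)
     = - (2^-1 *: (current Ov fn x + current Ov fn1 x))).

Definition scheme3 (dt : R) (Ov : set 'rV[R]_d) fn En Eh fn1 En1 : Prop :=
  [/\ forall x, (dt / 2)^-1 *: (Eh x - En x) = - current Ov fn x,
      forall x v, Ov v ->
        (fn1 x v - fn x v) / dt + dotp v (grad_x (favg fn fn1) x v)
          + dotp (Eh x) (grad_v (favg fn fn1) x v) = 0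
    & forall x, (dt / 2)^-1 *: (En1 x - Eh x) = - current Ov fn1 x].

(* The field at time n - 1/2, where [Eh n] is the field at time n + 1/2. *)
Definition Ehalf_prev (dt : R) (Ov : set 'rV[R]_d)
    (f0 : 'rV[R]_d -> 'rV[R]_d -> R) (E0 : 'rV[R]_d -> 'rV[R]_d)
    (Eh : nat -> 'rV[R]_d -> 'rV[R]_d) (n : nat) : 'rV[R]_d -> 'rV[R]_d :=
  if n is m.+1 then Eh m else fun x => E0 x + (dt / 2) *: current Ov f0 x.

(* Twice the kinetic energy. *)
Definition kinetic2 (a b : 'rV[R]_d) (Ov : set 'rV[R]_d) f : R :=
  \int[lebesgue_rV d]_(x in box a b)
    (\int[lebesgue_rV d]_(v in Ov) (f x v * dotp v v)).

Definition TE (a b : 'rV[R]_d) (Ov : set 'rV[R]_d) f E : R :=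
  2^-1 * (kinetic2 a b Ov f
          + \int[lebesgue_rV d]_(x in box a b) dotp (E x) (E x)).

(* [Ep] and [Em] are the fields at times n + 1/2 and n - 1/2. *)
Definition TE3 (a b : 'rV[R]_d) (Ov : set 'rV[R]_d) f
    (Ep Em : 'rV[R]_d -> 'rV[R]_d) : R :=
  2^-1 * (kinetic2 a b Ov f
          + \int[lebesgue_rV d]_(x in box a b) dotp (Ep x) (Em x)).

End vlasov_ampere.

(* Main.v *)
(** The kinetic energy balance is the [|v|^2]-moment of the Vlasov step. The
    transport term [v . grad_x g |v|^2] integrates to 0 by periodicity, and
    [F(x) . grad_v g |v|^2] integrates to [-2 F . J_g] by parts, so the change
    of the kinetic energy is a multiple of [int F . J_g]; the field update
    produces the opposite change.

    No integration by parts formula is assumed, and [Ov] has no boundary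
    regularity. By Fubini it is enough to work on lines: a bounded open subset
    of a line is a disjoint union of intervals at whose endpoints [g] vanishes;
    on a whole line, an integrable function with an integrable derivative is
    small along sequences tending to both ends. *)
Require Import Defs.
From mathcomp Require Import all_boot all_order all_algebra.
From mathcomp Require Import all_classical all_reals all_analysis.
From mathcomp Require Import measurable_realfun ring lra.
Import Order.TTheory GRing.Theory Num.Theory.
Import numFieldNormedType.Exports.
Local Open Scope classical_set_scope.
Local Open Scope ring_scope.
Set Implicit Arguments.
Unset Strict Implicit.
Unset Printing Implicit Defensive.

(** * Measurability and boxes in row vectors *)

Lemma measurable_rV_ball {R : realType} {d : nat} (x : 'rV[R]_d) (e : R) :
  measurable (ball x e).
Proof.
(* A ball of nonpositive radius is empty, whereas for [d = 0] the coordinate conditions below are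
   vacuous, so this case is separate. *)
have [e0|e0] := ltP 0 e; last first.
  rewrite (_ : ball x e = set0)//; apply/seteqP; split => // y [+ _].
  by rewrite ltNge e0.
rewrite (_ : ball x e = \bigcap_(i in [set: 'I_d]) rV_coord i @^-1` ball (x 0 i) e).
  apply: fin_bigcap_measurable; first exact: finite_finset.
  move=> i _; rewrite -[X in measurable X]setTI; apply: measurable_rV_coord => //.
  by apply: open_measurable; exact: ball_open.
apply/seteqP; split => [y [_ xy] i _|y xy]; first exact: xy.
by split => // i j; rewrite ord1; exact: xy.
Qed.

(** An open set is the union of the balls with rational centre and radius [1/(k+1)] that it
    contains, and there are countably many of them. *)
Lemma open_measurable_rV {R : realType} {d : nat} (U : set 'rV[R]_d) :
  open U -> measurable U.
Proof.
move=> oU.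
pose B (p : 'rV[rat]_d * nat) : set 'rV[R]_d := ball (map_mx ratr p.1 : 'rV[R]_d) (p.2.+1%:R^-1).
rewrite (_ : U = \bigcup_p (if `[< B p `<=` U >] then B p else set0)).
  apply: countable_bigcupT_measurable => // p.
  by case: ifP => // _; exact: measurable_rV_ball.
apply/seteqP; split => [x Ux|x [p _]]; last by case: ifPn => // /asboolP; exact.
have /nbhs_ballP[e /= e0 xeU] := open_nbhs_nbhs (conj oU Ux).
(* With a radius below [e / 2], any such ball containing [x] stays inside the ball of radius [e]
   about [x]. *)
have [k] : exists k, k.+1%:R^-1 < e / 2.
  have e20 : 0 < e / 2 by rewrite divr_gt0.
  near \oo => k; exists k; near: k; exact: near_infty_natSinv_lt (PosNum e20).
have : (0 : R) < k.+1%:R^-1 by rewrite invr_gt0.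
set r : R := k.+1%:R^-1 => r0 re.
have /choice[q xq] i : exists q : rat, x 0 i - r < ratr q < x 0 i + r.
  have /rat_in_itvoo[q] : x 0 i - r < x 0 i + r by lra.
  by rewrite in_itv/=; exists q.
have Bx : B (\row_i q i, k) x.
  split => // i j; rewrite !mxE ord1 /ball/= ltr_distlC.
  have := xq j; move: (ratr _) => t /andP[h1 h2]; by rewrite -/r; apply/andP; split; lra.
exists (\row_i q i, k) => //; rewrite ifT//; apply/asboolP => y By.
apply: xeU; apply: (@le_ball _ _ _ (r + r)); first by clearbody r; lra.
exact: ball_triangle (ball_sym Bx) By.
Unshelve. all: by end_near. Qed.

Lemma continuous_measurable_rV {R : realType} {d : nat} (f : 'rV[R]_d -> R) :
  continuous f -> measurable_fun setT f.
Proof.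
move=> /continuousP cf; apply: (measurability _ (RGenOpens.measurableE R)).
by move=> _ [_ [a [b ->] <-]]; rewrite setTI; apply: open_measurable_rV; exact/cf/interval_open.
Qed.

Lemma measurable_box {R : realType} {d : nat} (a b : 'rV[R]_d) : measurable (box a b).
Proof.
rewrite (_ : box a b = \bigcap_(i in [set: 'I_d]) rV_coord i @^-1` `[a 0 i, b 0 i]).
  apply: fin_bigcap_measurable; first exact: finite_finset.
  by move=> i _; rewrite -[X in measurable X]setTI; exact: measurable_rV_coord.
apply/seteqP; split => [y xy i _|y xy i]; first by rewrite /= in_itv/=; exact: xy.
by have := xy i I; rewrite /= in_itv.
Qed.

Lemma compact_box {R : realType} {d : nat} (a b : 'rV[R]_d) : compact (box a b).
Proof.
rewrite (_ : box a b = [set x | forall i, `[a 0 i, b 0 i]%classic (x 0 i)]).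
  apply: (@rV_compact _ _ (fun i => `[a 0 i, b 0 i]%classic)) => i.
  exact: segment_compact.
by apply/seteqP; split => y /= + i => /(_ i); rewrite in_itv.
Qed.

Lemma lebesgue_rV_box_lty {R : realType} {d : nat} (a b : 'rV[R]_d) :
  (lebesgue_rV d (box a b) < +oo)%E.
Proof.
elim: d a b => [a b|d IH a b]; first by rewrite /= diracE ltry.
rewrite /= /lebesgue_cons /pushforward.
rewrite (_ : _ @^-1` _ = `[a 0 0, b 0 0]%classic `*`
   box (\row_i a 0 (lift ord0 i)) (\row_i b 0 (lift ord0 i))).
  rewrite product_measure1E//; last exact: measurable_box.
  apply: lte_mul_pinfty; [exact: measure_ge0| |exact: IH].
  rewrite ge0_fin_numE//; apply: compact_finite_measure; exact: segment_compact.
apply/seteqP; split => -[t y] /=.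
  move=> H; split => /=; first by have := H 0; rewrite mxE unlift_none in_itv.
  by move=> i; rewrite !mxE; have := H (lift ord0 i); rewrite mxE liftK.
move=> [ht hy] i; case: (unliftP ord0 i) => [j ->|->]; rewrite mxE ?liftK ?unlift_none/=.
  by have := hy j; rewrite !mxE.
by move: ht; rewrite in_itv.
Qed.

Lemma continuous_box_bounded {R : realType} {d : nat} (a b : 'rV[R]_d) (f : 'rV[R]_d -> R) :
  continuous f -> exists M, forall x, box a b x -> `|f x| <= M.
Proof.
move=> cf.
have [|M [Mr HM]] := @compact_bounded _ _ (f @` box a b).
  by apply: continuous_compact; [exact: continuous_subspaceT|exact: compact_box].
exists (M + 1) => x bx; apply: HM; first by rewrite ltrDl.
by exists x.
Qed.

Lemma continuous_box_integrable {R : realType} {d : nat} (a b : 'rV[R]_d) (f : 'rV[R]_d -> R) :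
  continuous f -> (lebesgue_rV d).-integrable (box a b) (EFin \o f).
Proof.
move=> cf; apply: measurable_bounded_integrable; [exact: measurable_box|exact: lebesgue_rV_box_lty| |].
  exact: measurable_funTS (continuous_measurable_rV cf).
have [M HM] := continuous_box_bounded a b cf.
exists M; split; first exact: num_real.
by move=> y My x bx; exact: le_trans (HM _ bx) (ltW My).
Qed.

(** Splits off the first coordinate; with the companion equality of integrals it drives the
    induction on the dimension in [integral_lines0]. *)
Lemma integrable_rV_cons {R : realType} {d : nat} (f : 'rV[R]_d.+1 -> \bar R) :
  (lebesgue_rV d.+1).-integrable setT f ->
  (lebesgue_measure \x lebesgue_rV d)%E.-integrable setT (f \o rV_cons).
Proof.
move=> /integrableP[mf foo]; apply/integrableP; split.
  exact: measurableT_comp mf measurable_rV_cons.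
rewrite /= /lebesgue_cons ge0_integral_pushforward// in foo.
  exact: measurable_rV_cons.
exact: measurableT_comp.
Qed.

Lemma integral_rV_cons {R : realType} {d : nat} (f : 'rV[R]_d.+1 -> \bar R) :
  (lebesgue_rV d.+1).-integrable setT f ->
  (\int[lebesgue_rV d.+1]_x f x = \int[lebesgue_measure \x lebesgue_rV d]_p f (rV_cons p))%E.
Proof.
move=> fi; have [mf _] := integrableP _ _ _ fi.
rewrite /= /lebesgue_cons integral_pushforward//.
  exact: measurable_rV_cons.
by rewrite preimage_setT; exact: integrable_rV_cons.
Qed.

(** * Integration along lines *)

Lemma rV_cons_shift0 {R : realType} {d : nat} (s : R) (y : 'rV[R]_d) :
  rV_cons (0, y) + s *: delta_mx 0 ord0 = rV_cons (s, y).
Proof.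
apply/rowP => k; rewrite !mxE eqxx/=; case: (unliftP ord0 k) => [j ->|->].
  by rewrite eq_sym (negbTE (neq_lift _ _)) mulr0 addr0.
by rewrite eqxx mulr1 add0r.
Qed.

Lemma rV_cons_shift {R : realType} {d : nat} (t s : R) (y : 'rV[R]_d) (j : 'I_d) :
  rV_cons (t, y) + s *: delta_mx 0 (lift ord0 j) = rV_cons (t, y + s *: delta_mx 0 j).
Proof.
apply/rowP => k; rewrite !mxE eqxx/=; case: (unliftP ord0 k) => [l ->|->].
  by rewrite !mxE eqxx (inj_eq lift_inj).
by rewrite (negbTE (neq_lift _ _)) mulr0 addr0.
Qed.

(* [K] carries an additional function which is then known to be integrable on
   the lines considered: on the whole space, the integral of a derivative over
   a line is only known to vanish if its primitive is integrable too. *)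
Lemma integral_lines0 {R : realType} {d : nat} (i : 'I_d) (H K : 'rV[R]_d -> R) :
  (lebesgue_rV d).-integrable setT (EFin \o H) ->
  (lebesgue_rV d).-integrable setT (EFin \o K) ->
  (forall y, let line s := y + s *: delta_mx 0 i in
    lebesgue_measure.-integrable setT (EFin \o (H \o line)) ->
    lebesgue_measure.-integrable setT (EFin \o (K \o line)) ->
    (\int[lebesgue_measure]_s (H (line s))%:E = 0)%E) ->
  (\int[lebesgue_rV d]_x (H x)%:E = 0)%E.
Proof.
elim: d i H K => [[]//|d IH] i H K iH iK H0.
have iHc := integrable_rV_cons iH; have iKc := integrable_rV_cons iK.
rewrite (integral_rV_cons iH).
case: (unliftP ord0 i) H0 => [j ->|->] H0.
  (* The direction is a tail coordinate: the induction hypothesis applies to the slices at fixed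
     [t], which are integrable for almost every [t]. *)
  rewrite -(integral12_prod_meas1 iHc) -[RHS](integral0 lebesgue_measure setT).
  apply: ae_eq_integral => //; first exact: measurable_fubini_F iHc.
  have := ae_integrable1 iKc; have := ae_integrable1 iHc.
  apply: filterS2 => t iHt iKt _.
  apply: (IH j (fun y => H (rV_cons (t, y))) (fun y => K (rV_cons (t, y))) iHt iKt) => y.
  have := H0 (rV_cons (t, y)); cbv zeta.
  have -> : (fun s => rV_cons (t, y) + s *: delta_mx 0 (lift ord0 j)) =
    (fun s => rV_cons (t, y + s *: delta_mx 0 j)).
    by apply/funext => s; rewrite rV_cons_shift.
  move=> h iHl iKl; rewrite -(h iHl iKl).
  by apply: eq_integral => s _; rewrite rV_cons_shift.
(* The direction is the first coordinate: integrating over it first gives, for almost every [y], an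
   integral over the line through [(0, y)]. *)
rewrite -(integral21_prod_meas1 iHc) -[RHS](integral0 (lebesgue_rV d) setT).
apply: ae_eq_integral => //; first exact: measurable_fubini_G iHc.
have := ae_integrable2 iKc; have := ae_integrable2 iHc.
apply: filterS2 => y iHy iKy _.
have := H0 (rV_cons (0, y)); cbv zeta.
have -> : (fun s => rV_cons (0, y) + s *: delta_mx 0 ord0) = (fun s => rV_cons (s, y)).
  by apply/funext => s; rewrite rV_cons_shift0.
move=> h; rewrite -(h iHy iKy).
by apply: eq_integral => s _; rewrite rV_cons_shift0.
Qed.

(** * Integrals of derivatives on open subsets of the line *)

Section real_line.
Context {R : realType}.
Implicit Types (h g : R -> R) (I O : set R).
Notation mu := (@lebesgue_measure R).

Lemma integral_is_derive_itv h g (a b : R) : a < b ->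
  (forall t, a <= t <= b -> is_derive t 1 h (g t)) ->
  (forall t, a <= t <= b -> {for t, continuous g}) ->
  (\int[mu]_(t in `[a, b]) (g t)%:E = (h b - h a)%:E)%E.
Proof.
move=> ab dh cg.
have ch t : a <= t <= b -> {for t, continuous h}.
  move=> /dh dht; apply/differentiable_continuous; rewrite -derivable1_diffP.
  exact: ex_derive.
rewrite EFinB; apply: continuous_FTC2 => //.
- by apply: continuous_in_subspaceT => t /[!inE]/=; rewrite in_itv/=; exact: cg.
- split.
  + by move=> t /[!in_itv]/= /andP[at_ tb]; have := dh t; rewrite !ltW// => /(_ isT)[].
  + by apply: cvg_at_right_filter; apply: ch; rewrite lexx ltW.
  + by apply: cvg_at_left_filter; apply: ch; rewrite lexx ltW.
- move=> t /[!in_itv]/= /andP[at_ tb].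
  by have := dh t; rewrite !ltW// derive1E => /(_ isT)[].
Qed.

(** The fundamental theorem holds on each [[a n, b n]], and dominated convergence with bound [|g|]
    passes to the limit. Nothing is assumed of [h] at the ends of [I], so the endpoints can be
    chosen to suit each application. *)
Lemma cvg_increment_integral h g I (a b : nat -> R) :
  measurable I -> mu.-integrable I (EFin \o g) ->
  (forall t, I t -> is_derive t 1 h (g t)) ->
  (forall t, I t -> {for t, continuous g}) ->
  (forall n, a n < b n) ->
  (forall n t, a n <= t <= b n -> I t) ->
  (forall t, I t -> \forall n \near \oo, a n <= t <= b n) ->
  (h (b n) - h (a n))%:E @[n --> \oo] --> (\int[mu]_(t in I) (g t)%:E)%E.
Proof.
move=> mI ig dh cg ab abI Iab.
pose f_ n := (EFin \o g) \_ `[a n, b n].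
have mg := measurable_int _ ig.
have [] // := @dominated_convergence _ _ _ mu I mI f_ (EFin \o g) (abse \o (EFin \o g)).
- move=> n; apply/(measurable_restrict _ _ _).1 => //.
  by apply: measurable_funS mg => // t [].
- apply: aeW => t It; apply: cvg_near_cst.
  have := Iab _ It; apply: filterS => n abt.
  by rewrite /f_ patchE mem_set//= in_itv.
- exact: integrable_abse.
- apply: aeW => t n It /=; rewrite /f_ patchE; case: ifPn => // _.
  by rewrite /= normr0 lee_fin.
move=> _ _; rewrite (_ : [sequence _]_n = fun n => (h (b n) - h (a n))%:E)//.
apply/funext => n.
transitivity (\int[mu]_(t in I `&` `[a n, b n]) (g t)%:E)%E.
  by rewrite integral_mkcondr.
rewrite (_ : I `&` _ = `[a n, b n]%classic).
  by apply: integral_is_derive_itv => // t /abI; [exact: dh|exact: cg].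
by apply/seteqP; split => [t []//|t /= tab]; split => //; apply: (abI n); move: tab; rewrite in_itv.
Qed.

(** Otherwise [|h|] is at least [e] throughout a set of infinite measure, and its integral is
    infinite. *)
Lemma integrable_small h I (e : R) : measurable I -> mu I = +oo%E ->
  mu.-integrable I (EFin \o h) -> 0 < e -> exists2 t, I t & `|h t| < e.
Proof.
move=> mI Ioo ih e0; apply: contrapT => nex.
have /integrableP[mh] := ih; apply/negP; rewrite -leNgt.
apply: (@le_trans _ _ (\int[mu]_(t in I) (cst e%:E t))%E).
  by rewrite integral_cst// [X in (_ * X)%E]Ioo gt0_muley// lte_fin.
apply: ge0_le_integral => //.
- by move=> t _; rewrite lee_fin ltW.
- exact: measurableT_comp.
- move=> t It; rewrite lee_fin leNgt; apply/negP => te; apply: nex.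
  by exists t.
Qed.

Lemma integral_is_deriveT0 h g :
  (forall t : R, is_derive t 1 h (g t)) -> continuous g ->
  mu.-integrable setT (EFin \o h) -> mu.-integrable setT (EFin \o g) ->
  (\int[mu]_t (g t)%:E = 0)%E.
Proof.
move=> dh cg ih ig.
(* The endpoints are chosen where [h] is small: only the integrability of [h]
   provides such points. *)
have /choice[b hb] (n : nat) : exists t, n.+1%:R <= t /\ `|h t| < n.+1%:R^-1.
  have [||||t] := @integrable_small h `[n.+1%:R, +oo[ (n.+1%:R^-1) => //.
  - by rewrite lebesgue_measure_itv/= ltry.
  - exact: integrableS ih.
  - by rewrite /= in_itv/= andbT => nt ht; exists t.
have /choice[a ha] (n : nat) : exists t, t <= - n.+1%:R /\ `|h t| < n.+1%:R^-1.
  have [||||t] := @integrable_small h `]-oo, - n.+1%:R] (n.+1%:R^-1) => //.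
  - by rewrite lebesgue_measure_itv/= ltNyr.
  - exact: integrableS ih.
  - by rewrite /= in_itv/= => nt ht; exists t.
have h0 (u : nat -> R) : (forall n, `|h (u n)| < n.+1%:R^-1) -> h (u n) @[n --> \oo] --> (0 : R).
  move=> hu; apply/cvgr0Pnorm_lt => e e0; near=> n.
  apply: lt_trans (hu n) _; near: n; exact: near_infty_natSinv_lt (PosNum e0).
have inc := @cvg_increment_integral h g setT a b measurableT ig (fun t _ => dh t)
  (fun t _ => cg t).
apply: cvg_unique (inc _ _ _) _ => //.
- move=> n; apply: (@le_lt_trans _ _ 0); first by rewrite (le_trans (ha n).1)// oppr_le0.
  by rewrite (lt_le_trans _ (hb n).1).
- move=> t _; near=> n; have tn : `|t| <= n.+1%:R.
    near: n; exists (Num.trunc `|t|) => // n /= tn.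
    by rewrite ltW// (lt_le_trans (truncnS_gt _))// ler_nat.
  move: tn; rewrite ler_norml => /andP[tn1 tn2].
  by rewrite (le_trans (ha n).1)// (le_trans tn2 (hb n).1).
- apply/cvg_EFin; first by near=> n.
  rewrite -(subrr 0); apply: cvgB; apply: h0 => n; [exact: (hb n).2|exact: (ha n).2].
Unshelve. all: by end_near. Qed.

(** The derivative is given inside only, so the interval is exhausted from within and continuity of
    [h] at the ends gives the limits. *)
Lemma integral_is_derive_oo h g (a b : R) : a < b ->
  {for a, continuous h} -> {for b, continuous h} ->
  (forall t, a < t < b -> is_derive t 1 h (g t)) ->
  (forall t, a < t < b -> {for t, continuous g}) ->
  mu.-integrable `]a, b[ (EFin \o g) ->
  (\int[mu]_(t in `]a, b[) (g t)%:E = (h b - h a)%:E)%E.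
Proof.
move=> ab ca cb dh cg ig.
(* The shift by 3 makes [2 * e n < b - a] already at [n = 0], so the inner intervals are never
   degenerate. *)
pose e n : R := (b - a) * n.+3%:R^-1.
have e0 n : 0 < e n by rewrite mulr_gt0 ?subr_gt0.
have e2 n : e n + e n < b - a.
  have -> : e n + e n = (b - a) * (n.+3%:R^-1 * 2) by rewrite /e; ring.
  rewrite gtr_pMr ?subr_gt0//.
  by rewrite mulrC ltr_pdivrMr// mul1r ltr_nat.
have cve : e n @[n --> \oo] --> (0 : R).
  rewrite -(mulr0 (b - a)); apply: cvgMr.
  have := @cvg_harmonic R; rewrite -(cvg_shiftn 2).
  by apply: cvg_trans; apply: near_eq_cvg; near=> n; rewrite /harmonic/= addn2.
have := @cvg_increment_integral h g `]a, b[ (fun n => a + e n) (fun n => b - e n) _ ig _ _ _ _ _.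
move=> inc; apply: cvg_unique (inc _ _ _ _ _ _) _ => // {inc}.
- by move=> n; have := e2 n; lra.
- by move=> n t; rewrite /= in_itv/=; have := e0 n; move: (e n) => r r0 /andP[? ?]; apply/andP; split; lra.
- move=> t; rewrite /= in_itv/= => /andP[at_ tb].
  have m0 : 0 < Num.min (t - a) (b - t) by rewrite lt_min !subr_gt0 at_.
  have /cvgr0Pnorm_lt/(_ _ m0) := cve; apply: filterS => n.
  rewrite gtr0_norm// lt_min => /andP[? ?]; apply/andP; split; lra.
- apply/cvg_EFin; first by near=> n.
  apply: cvgB.
  + by apply: continuous_cvg => //; rewrite -{2}(subr0 b); apply: cvgB => //; exact: cvg_cst.
  + by apply: continuous_cvg => //; rewrite -{2}(addr0 a); apply: cvgD => //; exact: cvg_cst.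
Unshelve. all: by end_near. Qed.

Lemma integral_is_derive_bounded_open0 h g O :
  open O -> bounded_set O -> continuous h -> (forall t, ~ O t -> h t = 0) ->
  (forall t, O t -> is_derive t 1 h (g t)) ->
  (forall t, O t -> {for t, continuous g}) ->
  mu.-integrable O (EFin \o g) ->
  (\int[mu]_(t in O) (g t)%:E = 0)%E.
Proof.
move=> oO [M [_ bO]] ch h0 dh cg ig.
pose I := open_disjoint_itv oO.
have OI : O = \bigcup_q I q := open_disjoint_itv_bigcup oO.
have tI : trivIset setT I := @open_disjoint_itv_trivIset _ _ oO.
have oI q : open (I q) := @open_disjoint_itv_open _ _ oO q.
have iI q : is_interval (I q) := @open_disjoint_itv_is_interval _ _ oO q.
have IO q : I q `<=` O by rewrite OI; exact: bigcup_sup.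
have MO t : O t -> `|t| <= M + 1 by apply: bO; rewrite ltrDl.
have lI q : has_lbound (I q).
  by exists (- (M + 1)) => t /IO /MO; rewrite ler_norml => /andP[].
have uI q : has_ubound (I q).
  by exists (M + 1) => t /IO /MO; rewrite ler_norml => /andP[].
have IE q : I q = `]inf (I q), sup (I q)[%classic.
  rewrite -{1}((interior_id _).1 (oI q)) interval_bounded_interior//.
(* Hence the endpoints of the component [I q] are not in [O]. *)
have apart q t : ~ I q t -> O t -> exists2 e, 0 < e & forall u, I q u -> e <= `|t - u|.
  move=> nIt; rewrite {1}OI => -[r _ Irt].
  have /nbhs_ballP[e /= e0 teI] := open_nbhs_nbhs (conj (oI r) Irt).
  exists e => // u Iu; rewrite leNgt; apply/negP => tu.
  have qr : q != r by apply/eqP => qr; apply: nIt; rewrite qr.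
  have /trivIsetP/(_ q r Logic.I Logic.I qr) := tI.
  by move=> E; have : set0 u by rewrite -E; split => //; exact: teI.
have mI q : measurable (I q) by exact: open_measurable.
rewrite OI integral_bigcup//; last by rewrite -OI.
apply: eseries0 => q _ _.
have := IE q; move: (inf _) (sup _) => a b Iab.
(* An index with [b <= a] stands for an empty component, which contributes 0. *)
have [ab|ba] := ltP a b; last by rewrite Iab set_itv_ge ?integral_set0// bnd_simp -leNgt.
have Iq t : a < t < b -> I q t by rewrite Iab /= in_itv.
(* The component has points as close as desired to each of its ends. If an end were in [O], this
   would contradict the gap given by [apart]. *)
have half_gap e : 0 < e -> exists2 m, 0 < m < e & a < a + m < b /\ a < b - m < b.
  move=> e0; pose m := Num.min e (b - a).
  have m0 : 0 < m by rewrite lt_min e0 subr_gt0.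
  have [me mb] : m <= e /\ m <= b - a by split; rewrite ge_min lexx ?orbT.
  by exists (m / 2); [|split]; apply/andP; split; lra.
have nOa : ~ O a.
  have nIa : ~ I q a by rewrite Iab /= in_itv/= ltxx.
  move=> /(apart _ _ nIa)[e e0] eI.
  have [m /andP[m0 me] [/Iq/eI + _]] := half_gap _ e0.
  by rewrite opprD addrA subrr sub0r normrN gtr0_norm// leNgt me.
have nOb : ~ O b.
  have nIb : ~ I q b by rewrite Iab /= in_itv/= ltxx andbF.
  move=> /(apart _ _ nIb)[e e0] eI.
  have [m /andP[m0 me] [_ /Iq/eI]] := half_gap _ e0.
  by rewrite opprB addrC subrK gtr0_norm// leNgt me.
have -> : (\int[mu]_(t in I q) (g t)%:E = (h b - h a)%:E)%E.
  rewrite Iab; apply: integral_is_derive_oo => //.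
  - exact: ch.
  - exact: ch.
  - by move=> t /Iq/IO; exact: dh.
  - by move=> t /Iq/IO; exact: cg.
  - rewrite -Iab; apply: integrableS ig => //; exact: open_measurable.
by rewrite !h0// subrr.
Qed.

End real_line.

(** * Fubini's theorem on rectangles *)

Section fubini_rectangle.
Context d1 d2 (T1 : measurableType d1) (T2 : measurableType d2) (R : realType).
Variable m1 : {sigma_finite_measure set T1 -> \bar R}.
Variable m2 : {sigma_finite_measure set T2 -> \bar R}.
Variables (A : set T1) (B : set T2) (g : T1 -> T2 -> R).
Hypotheses (mA : measurable A) (mB : measurable B).
Hypothesis ig : (m1 \x m2)%E.-integrable (A `*` B) (fun z => (g z.1 z.2)%:E).

(** Extending by 0 off the rectangle reduces everything to Fubini's theorem on the whole product. *)
Let f : T1 * T2 -> \bar R := (fun z => (g z.1 z.2)%:E) \_ (A `*` B).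

Let fE1 x : A x -> (fun y => f (x, y)) = (EFin \o g x) \_ B.
Proof.
move=> Ax; apply/funext => y; rewrite /f !patchE; congr (if _ then _ else _).
by apply/idP/idP => /[!inE]; [case|split].
Qed.

Let fE2 y : B y -> (fun x => f (x, y)) = (EFin \o g^~ y) \_ A.
Proof.
move=> By; apply/funext => x; rewrite /f !patchE; congr (if _ then _ else _).
by apply/idP/idP => /[!inE]; [case|split].
Qed.

Let fN1 x : ~ A x -> (fun y => f (x, y)) = cst 0%E.
Proof.
by move=> nA; apply/funext => y; rewrite /f patchE memNset// => -[].
Qed.

Let fN2 y : ~ B y -> (fun x => f (x, y)) = cst 0%E.
Proof.
by move=> nB; apply/funext => x; rewrite /f patchE memNset// => -[].
Qed.

Let mAB : measurable (A `*` B). Proof. exact: measurableX. Qed.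

Let if_ : (m1 \x m2)%E.-integrable setT f.
Proof. exact/(integrable_mkcond _ mAB).1. Qed.

Lemma ae_integrable_rectangle :
  {ae m1, forall x, A x -> m2.-integrable B (EFin \o g x)}.
Proof.
have := ae_integrable1 if_; apply: filterS => x + Ax.
by rewrite fE1// => /(integrable_mkcond _ mB).2.
Qed.

Let F1E : (fun x => (\int[m2]_(y in B) g x y)%:E) \_ A = EFin \o fine \o fubini_F m2 f.
Proof.
apply/funext => x; rewrite patchE /fubini_F /=; case: ifPn => [/[!inE] Ax|/negP].
  by rewrite fE1// -integral_mkcond.
by rewrite inE => nA; rewrite fN1// integral0.
Qed.

Let F2E : (fun y => (\int[m1]_(x in A) g x y)%:E) \_ B = EFin \o fine \o fubini_G m1 f.
Proof.
apply/funext => y; rewrite patchE /fubini_G /=; case: ifPn => [/[!inE] By|/negP].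
  by rewrite fE2// -integral_mkcond.
by rewrite inE => nB; rewrite fN2// integral0.
Qed.

(** The function [fine], hidden in [Rintegral], sends infinite values to 0; for an integrable [F]
    these occur on a null set only. *)
Let fineK_integrable d (T : measurableType d) (mu : {measure set T -> \bar R}) (F : T -> \bar R) :
  mu.-integrable setT F -> mu.-integrable setT (EFin \o fine \o F) /\
  (\int[mu]_x (EFin \o fine \o F) x = \int[mu]_x F x)%E.
Proof.
move=> iF; have [mF _] := integrableP _ _ _ iF.
have mfF : measurable_fun setT (EFin \o fine \o F).
  by apply/measurable_EFinP; exact: measurableT_comp.
split.
  apply: le_integrable iF => // x _ /=; case: (F x) => [r| |]//=.
    by rewrite normr0 leey.
  by rewrite normr0 leey.
apply: ae_eq_integral => //; apply: filterS (integrable_ae measurableT iF) => x /= + _.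
by move=> /(_ Logic.I) /fineK.
Qed.

Lemma integrable_Rintegral_rectangle :
  m1.-integrable A (fun x => (\int[m2]_(y in B) g x y)%:E).
Proof.
apply/(integrable_mkcond _ mA).2; rewrite F1E.
exact: (fineK_integrable (integrable_fubini_F if_)).1.
Qed.

Lemma Rintegral12_rectangle :
  \int[m1]_(x in A) (\int[m2]_(y in B) g x y)
  = \int[(m1 \x m2)%E]_(z in A `*` B) g z.1 z.2.
Proof.
rewrite {1}/Rintegral integral_mkcond F1E.
rewrite (fineK_integrable (integrable_fubini_F if_)).2.
by rewrite integral12_prod_meas1// /Rintegral [in RHS]integral_mkcond.
Qed.

Lemma Rintegral21_rectangle :
  \int[m2]_(y in B) (\int[m1]_(x in A) g x y)
  = \int[(m1 \x m2)%E]_(z in A `*` B) g z.1 z.2.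
Proof.
rewrite {1}/Rintegral integral_mkcond F2E.
rewrite (fineK_integrable _).2; last first.
  (* The partial integral over [A] is dominated by that of [|f|], whose integral is finite by
     Tonelli's theorem. *)
  have [mf _] := integrableP _ _ _ if_.
  have mf2 := @measurable_fun_fubini_tonelli_G _ _ _ _ _ m1 (abse \o f)
    (measurableT_comp (@abse_measurable R setT) mf) (fun=> abse_ge0 _).
  apply/integrableP; split; first exact: measurable_fubini_G if_.
  apply: le_lt_trans ((integrable21ltyP _ _ mf).1 if_).
  apply: ge0_le_integral => //.
  - exact/measurableT_comp/(measurable_fubini_G if_).
  - move=> y _; apply: le_abse_integral => //.
    exact: measurableT_comp mf (pair2_measurable _).
by rewrite integral21_prod_meas1// /Rintegral [in RHS]integral_mkcond.
Qed.

End fubini_rectangle.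

(** * Partial derivatives *)

(** The two difference quotients are the same function of [h]. The main instances of [phi] are lines
    and the injections [y |-> (y, v)] and [y |-> (x, y)]. *)
Lemma derive_affineE {R : realType} {U V W : normedModType R} (phi : U -> V)
    (F : V -> W) (a u : U) (w : V) :
  (forall h : R, phi (h *: u + a) = h *: w + phi a) ->
  'D_u (F \o phi) a = 'D_w F (phi a) /\
  (derivable (F \o phi) a u <-> derivable F (phi a) w).
Proof.
move=> phiE.
have E : (fun h : R => h^-1 *: ((F \o phi \o shift a) (h *: u) - (F \o phi) a)) =
    (fun h : R => h^-1 *: ((F \o shift (phi a)) (h *: w) - F (phi a))).
  by apply/funext => h /=; rewrite phiE.
by rewrite /derivable /derive E.
Qed.

Lemma is_derive_affine {R : realType} {U V W : normedModType R} (phi : U -> V)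
    (F : V -> W) (a u : U) (w : V) (l : W) :
  (forall h : R, phi (h *: u + a) = h *: w + phi a) ->
  is_derive (phi a) w F l -> is_derive a u (F \o phi) l.
Proof.
by move=> phiE [dF <-]; have [E /iffRL/(_ dF) ?] := derive_affineE F phiE; split.
Qed.

Section row_calculus.
Context {R : realType} {d : nat}.
Implicit Types (v w : 'rV[R]_d) (i j : 'I_d).

Lemma is_derive_coord v w j : is_derive v w (fun u : 'rV[R]_d => u 0 j) (w 0 j).
Proof.
(* Here the coordinate plays the part of [phi], and [F] is the identity of [R]. *)
apply: (@is_derive_affine _ _ _ _ (fun u : 'rV[R]_d => u 0 j) id v w (w 0 j) (w 0 j)).
by move=> h; rewrite !mxE.
Qed.

Lemma continuous_dotp (F G : 'rV[R]_d -> 'rV[R]_d) :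
  continuous F -> continuous G -> continuous (fun x => dotp (F x) (G x)).
Proof.
move=> cF cG x; rewrite /dotp.
apply: (@cvg_big R^o _ +%R 0 xpredT _ _ (nbhs x) (index_enum 'I_d)
  (fun i u => F u 0 i * G u 0 i)) => [|i _]; first exact: add_continuous.
apply: (@continuousM _ _ (fun u => F u 0 i) (fun u => G u 0 i) x).
  by apply: (@continuous_comp _ _ _ F (fun u : 'rV[R]_d => u 0 i)); [exact: cF|exact: coord_continuous].
by apply: (@continuous_comp _ _ _ G (fun u : 'rV[R]_d => u 0 i)); [exact: cG|exact: coord_continuous].
Qed.

Lemma continuous_dotp_self : continuous (fun v : 'rV[R]_d => dotp v v).
Proof. by apply: continuous_dotp => v; exact: cvg_id. Qed.

Lemma is_derive_dotp_self v i :
  is_derive v (delta_mx 0 i) (fun u => dotp u u) (2 * v 0 i).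
Proof.
have dsq j : is_derive v (delta_mx 0 i) (fun u : 'rV[R]_d => u 0 j * u 0 j) (2 * (v 0 j * (j == i)%:R)).
  have := is_deriveM (is_derive_coord v (delta_mx 0 i) j) (is_derive_coord v (delta_mx 0 i) j).
  by move/is_derive_eq; apply; rewrite !mxE eqxx/= /GRing.scale/=; ring.
have := is_derive_sum dsq.
rewrite (_ : \sum_(j < d) (fun u : 'rV[R]_d => u 0 j * u 0 j) = fun u => dotp u u); last first.
  by apply/funext => u; rewrite fct_sumE.
move/is_derive_eq; apply.
rewrite (bigD1 i)//= eqxx mulr1 big1 ?addr0// => j /negbTE ->.
by rewrite !mulr0.
Qed.

Lemma continuous_line v w : continuous (fun s : R => v + s *: w).
Proof. by move=> s; apply: cvgD; [exact: cvg_cst|exact: scalel_continuous]. Qed.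

Lemma is_derive_line (F : 'rV[R]_d -> R) v w (s : R) l :
  is_derive (v + s *: w) w F l -> is_derive s 1 (fun t => F (v + t *: w)) l.
Proof.
apply: (@is_derive_affine _ _ _ _ (fun t : R => v + t *: w)) => h.
by rewrite scalerDl [h *: 1]mulr1 addrCA.
Qed.

(** The trace of [O] on a line parallel to the axis [i] is open, and either bounded or the whole
    line, so the one-dimensional results apply. [F] is the companion function in [integral_lines0],
    since the whole-line case needs an integrable primitive. *)
Lemma integral_pderiv_open0 i (O : set 'rV[R]_d) (F G : 'rV[R]_d -> R) :
  open O -> bounded_set O \/ O = setT ->
  continuous F -> (forall v, ~ O v -> F v = 0) ->
  (forall v, O v -> is_derive v (delta_mx 0 i) F (G v)) ->
  (forall v, O v -> {for v, continuous G}) ->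
  (lebesgue_rV d).-integrable setT (EFin \o F) ->
  (lebesgue_rV d).-integrable O (EFin \o G) ->
  (\int[lebesgue_rV d]_(v in O) (G v)%:E = 0)%E.
Proof.
move=> oO bO cF F0 dF cG iF iG.
have mO := open_measurable_rV oO.
rewrite integral_mkcond restrict_EFin.
apply: (integral_lines0 (i := i) _ iF).
  by rewrite -restrict_EFin; exact/(integrable_mkcond _ mO).1.
move=> y line; rewrite {}/line => iGl iFl.
pose line s := y + s *: delta_mx 0 i : 'rV[R]_d.
have cl : continuous line := @continuous_line _ _.
pose Ol := line @^-1` O.
have oOl : open Ol by apply: open_comp => // s _; exact: cl.
have mOl : measurable Ol by exact: open_measurable.
have GlE : (G \_ O) \o line = (G \o line) \_ Ol.
  by apply/funext => s; rewrite /= !patchE; congr (if _ then _ else _); apply/idP/idP; rewrite !inE.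
have iGOl : lebesgue_measure.-integrable Ol (EFin \o (G \o line)).
  apply/(@integrable_mkcond _ _ _ (@lebesgue_measure R) Ol _ mOl).2.
  rewrite restrict_EFin; move: iGl.
  by rewrite -[EFin \o _]/(EFin \o ((G \_ O) \o line)) GlE.
transitivity (\int[lebesgue_measure]_(s in Ol) ((G \o line) s)%:E)%E.
  rewrite [RHS]integral_mkcond; apply: eq_integral => s _.
  by rewrite -[(G \_ O) _]/(((G \_ O) \o line) s) GlE restrict_EFin.
have cFl : continuous (F \o line) by move=> s; apply: continuous_comp; [exact: cl|exact: cF].
have dFl s : Ol s -> is_derive s 1 (F \o line) ((G \o line) s).
  by move=> /dF; exact: is_derive_line.
have cGl s : Ol s -> {for s, continuous (G \o line)}.
  by move=> Os; apply: continuous_comp; [exact: cl|exact: cG].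
case: bO => [[M [Mr bO]]|OT].
  apply: (@integral_is_derive_bounded_open0 _ (F \o line)) => //.
    (* The trace of [O] is bounded because [|s| <= |line s| + |y|] in the sup norm. *)
    exists (M + 1 + `|y|); split; first exact: num_real.
    move=> x Mx s Os.
    have : `|line s| <= M + 1 by apply: bO => //; rewrite ltrDl.
    have := ler_normB (line s) y.
    rewrite {1}/line addrAC subrr add0r.
    have ss : `|s| <= `|s *: delta_mx 0 i : 'rV[R]_d|.
      rewrite [leRHS]/Num.norm/= mx_normrE; apply: le_trans (le_bigmax _ _ (0, i)).
      by rewrite !mxE/= !eqxx mulr1.
    move=> sy OM; apply: (le_trans ss); apply: (le_trans sy); apply: ltW.
    by apply: le_lt_trans Mx; rewrite lerD2r.
  by move=> s ns; apply: F0.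
have OlT : Ol = setT by rewrite /Ol OT preimage_setT.
rewrite OlT; apply: (@integral_is_deriveT0 _ (F \o line)) => //.
- by move=> s; apply: dFl; rewrite OlT.
- by move=> s; apply: cGl; rewrite OlT.
- by rewrite -OlT.
Qed.

(** A line in direction [i] meets the box in nothing or in a segment one period long, over which a
    periodic [F] has increment 0. *)
Lemma integral_box_pderiv0 (a b : 'rV[R]_d) i (F G : 'rV[R]_d -> R) :
  a 0 i < b 0 i -> box_periodic a b F -> continuous G ->
  (forall x, is_derive x (delta_mx 0 i) F (G x)) ->
  (\int[lebesgue_rV d]_(x in box a b) (G x)%:E = 0)%E.
Proof.
move=> ab pF cG dF.
have mB := measurable_box a b.
have iG : (lebesgue_rV d).-integrable setT (EFin \o (G \_ (box a b))).
  by rewrite -restrict_EFin; apply/(integrable_mkcond _ mB).1; exact: continuous_box_integrable.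
rewrite integral_mkcond restrict_EFin.
apply: (integral_lines0 (i := i) iG iG) => y line _ _.
pose s0 := a 0 i - y 0 i; pose s1 := b 0 i - y 0 i.
have lineE s : box a b (line s) <-> (forall j, j != i -> a 0 j <= y 0 j <= b 0 j) /\
    a 0 i - y 0 i <= s <= b 0 i - y 0 i.
  rewrite /box /line /=; split.
    move=> H; split.
      by move=> j ji; have := H j; rewrite !mxE (negbTE ji) andbF mulr0 addr0.
    by have := H i; rewrite !mxE !eqxx mulr1 => /andP[? ?]; apply/andP; split; lra.
  move=> [H1 /andP[H2 H3]] j; rewrite !mxE eqxx/=; have [->|ji] := eqVneq j i.
    by rewrite mulr1; apply/andP; split; lra.
  by rewrite mulr0 addr0; exact: H1.
have [out|off] := pselect (forall j, j != i -> a 0 j <= y 0 j <= b 0 j); last first.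
  apply: integral0_eq => s _; rewrite patchE memNset// => /lineE[].
  by move=> /off.
transitivity (\int[lebesgue_measure]_(s in `[s0, s1])
    ((G \o line) s)%:E)%E.
  rewrite [RHS]integral_mkcond; apply: eq_integral => s _.
  rewrite [RHS]patchE patchE /=; case: ifPn => [/set_mem/lineE[_ h]|/negP h].
    by rewrite mem_set//= in_itv.
  rewrite memNset//=; rewrite in_itv/= => h'; apply: h; apply/mem_set/lineE.
  by split.
transitivity ((F \o line) s1 - (F \o line) s0)%:E.
  apply: integral_is_derive_itv.
  - by rewrite /s0 /s1; lra.
  - by move=> s _; apply: is_derive_line; exact: dF.
  - by move=> s _; apply: continuous_comp; [exact: continuous_line|exact: cG].
rewrite /= /line -[s1](subrK s0) scalerDl.
rewrite (_ : s1 - s0 = b 0 i - a 0 i); last by rewrite /s0 /s1; ring.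
by rewrite [X in F X](addrCA y) addrC pF subrr.
Qed.

End row_calculus.

(** * Admissible densities *)

Section Rintegral_tools.
Context d (T : measurableType d) (R : realType).
Variables (mu : {measure set T -> \bar R}) (D : set T).
Hypothesis mD : measurable D.

Lemma integrable_bounded_mul (h g : T -> R) (M : R) :
  measurable_fun D h -> (forall x, D x -> `|h x| <= M) ->
  mu.-integrable D (EFin \o g) -> mu.-integrable D (fun x => (h x * g x)%:E).
Proof.
move=> mh hM ig.
rewrite (_ : (fun _ => _) = (EFin \o h) \* (EFin \o g))%E; last exact/funext.
apply: integrableMr => //; exists M; split; first exact: num_real.
by move=> y My x Dx; exact: le_trans (hM _ Dx) (ltW My).
Qed.

Lemma integrable_fin_sum (I : Type) (s : seq I) (h : I -> T -> R) :
  (forall i, mu.-integrable D (EFin \o h i)) ->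
  mu.-integrable D (fun x => (\sum_(i <- s) h i x)%:E).
Proof.
move=> ih; under eq_fun do rewrite -sumEFin.
by apply: integrable_sum => // i _; exact: ih.
Qed.

Lemma Rintegral_sum (I : Type) (s : seq I) (h : I -> T -> R) :
  (forall i, mu.-integrable D (EFin \o h i)) ->
  \int[mu]_(x in D) (\sum_(i <- s) h i x) = \sum_(i <- s) \int[mu]_(x in D) h i x.
Proof.
move=> ih; elim: s => [|i s IH].
  under eq_Rintegral do rewrite big_nil.
  by rewrite big_nil /Rintegral integral0.
under eq_Rintegral do rewrite big_cons.
by rewrite big_cons -IH RintegralD//; exact: integrable_fin_sum.
Qed.

Lemma ae_eq_Rintegral (g h : T -> R) :
  mu.-integrable D (EFin \o g) -> mu.-integrable D (EFin \o h) ->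
  {ae mu, forall x, D x -> g x = h x} ->
  \int[mu]_(x in D) g x = \int[mu]_(x in D) h x.
Proof.
move=> /integrableP[mg _] /integrableP[mh _] gh; congr fine.
by apply: ae_eq_integral => //; apply: filterS gh => x + Dx => /(_ Dx) ->.
Qed.

End Rintegral_tools.

Section admissible.
Context {R : realType} {d : nat}.
Variables (a b : 'rV[R]_d) (Ov : set 'rV[R]_d) (f : 'rV[R]_d -> 'rV[R]_d -> R).
Hypotheses (hbox : forall i, a 0 i < b 0 i) (hOv : velocity_domain Ov).
Hypothesis hf : admissible_f a b Ov f.

Lemma velocity_domain_open (U : set 'rV[R]_d) : velocity_domain U -> open U.
Proof. by case=> [[]//|->]; exact: openT. Qed.

Let oOv : open Ov. Proof. exact: velocity_domain_open. Qed.
Let mOv : measurable Ov. Proof. exact: open_measurable_rV. Qed.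
(** The density on the product space, where its regularity is assumed; the letter does not denote a
    current here. *)
Let J (z : 'rV[R]_d * 'rV[R]_d) : R := f z.1 z.2.

Let shift1 (h : R) (e x v : 'rV[R]_d) : (h *: e + x, v) = h *: (e, 0 : 'rV[R]_d) + (x, v).
Proof. by rewrite -[RHS]/(h *: e + x, h *: 0 + v) scaler0 add0r. Qed.

Let shift2 (h : R) (e x v : 'rV[R]_d) : (x, h *: e + v) = h *: (0 : 'rV[R]_d, e) + (x, v).
Proof. by rewrite -[RHS]/(h *: 0 + x, h *: e + v) scaler0 add0r. Qed.

(** Reading the gradients as directional derivatives of [J] gives access to their continuity. *)
Let grad_xE x v i : grad_x f x v 0 i = 'D_(delta_mx 0 i, 0) J (x, v).
Proof.
rewrite mxE; have := @derive_affineE _ _ _ _ (fun y => (y, v)) J x (delta_mx 0 i) (delta_mx 0 i, 0).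
by move=> /(_ (fun h => shift1 h _ _ _))[].
Qed.

Let grad_vE x v i : grad_v f x v 0 i = 'D_(0, delta_mx 0 i) J (x, v).
Proof.
rewrite mxE; have := @derive_affineE _ _ _ _ (fun y => (x, y)) J v (delta_mx 0 i) (0, delta_mx 0 i).
by move=> /(_ (fun h => shift2 h _ _ _))[].
Qed.

Let cpair1 v : continuous (fun x : 'rV[R]_d => (x, v) : 'rV[R]_d * 'rV[R]_d).
Proof. move=> x; apply: (@cvg_pair _ _ _ (nbhs x) (nbhs x) (nbhs v) _ _ _ id (cst v)).
  exact: cvg_id.
exact: cvg_cst. Qed.

Let cpair2 x : continuous (fun v : 'rV[R]_d => (x, v) : 'rV[R]_d * 'rV[R]_d).
Proof. move=> v; apply: (@cvg_pair _ _ _ (nbhs v) (nbhs x) (nbhs v) _ _ _ (cst x) id).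
  exact: cvg_cst.
exact: cvg_id. Qed.

Let diffJ x v : Ov v -> differentiable J (x, v).
Proof. by move=> Ovv; have [] := f_C1 hf (z := (x, v)) (conj Logic.I Ovv). Qed.

Let cDJ x v w : Ov v -> {for (x, v), continuous (fun y => 'D_w J y)}.
Proof. by move=> Ovv; have [_] := f_C1 hf (z := (x, v)) (conj Logic.I Ovv); exact. Qed.

Lemma is_derive_grad_x x v i : Ov v -> is_derive x (delta_mx 0 i) (f^~ v) (grad_x f x v 0 i).
Proof.
move=> Ovv; rewrite grad_xE.
have := @is_derive_affine _ _ _ _ (fun y => (y, v)) J x (delta_mx 0 i) (delta_mx 0 i, 0).
move=> /(_ _ (fun h => shift1 h _ _ _)); apply.
exact/derivableP/diff_derivable/diffJ.
Qed.

Lemma is_derive_grad_v x v i : Ov v -> is_derive v (delta_mx 0 i) (f x) (grad_v f x v 0 i).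
Proof.
move=> Ovv; rewrite grad_vE.
have := @is_derive_affine _ _ _ _ (fun y => (x, y)) J v (delta_mx 0 i) (0, delta_mx 0 i).
move=> /(_ _ (fun h => shift2 h _ _ _)); apply.
exact/derivableP/diff_derivable/diffJ.
Qed.

Lemma continuous_grad_x v i : Ov v -> continuous (fun x => grad_x f x v 0 i).
Proof.
move=> Ovv x; under eq_fun do rewrite grad_xE.
apply: (@continuous_comp _ _ _ (fun y => (y, v)) (fun y => 'D_(delta_mx 0 i, 0) J y)).
  exact: cpair1.
exact: cDJ.
Qed.

Lemma continuous_grad_v x v i : Ov v -> {for v, continuous (fun w => grad_v f x w 0 i)}.
Proof.
move=> Ovv.
rewrite (_ : (fun w => _) = (fun z => 'D_(0, delta_mx 0 i) J z) \o (fun w => (x, w))).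
  by apply: continuous_comp; [exact: cpair2|exact: cDJ].
by apply/funext => w /=; rewrite grad_vE.
Qed.

Lemma continuous_f_v x v : Ov v -> {for v, continuous (f x)}.
Proof.
move=> Ovv.
apply: (@continuous_comp _ _ _ (fun y => (x, y)) J).
  exact: cpair2.
exact/differentiable_continuous/diffJ.
Qed.

Lemma continuous_within_closure x : {within closure Ov, continuous (f x)}.
Proof.
apply/subspace_continuousP => v cv.
have /subspace_continuousP/(_ (x, v) (conj Logic.I cv)) := f_continuous hf.
apply: (@cvg_comp _ _ _ (fun w => (x, w)) J) => P HP.
suff : nbhs v [set w | closure Ov w -> P (x, w)] by [].
have : nbhs v [set w | (setT `*` closure Ov) (x, w) -> P (x, w)] := cpair2 HP.
by apply: filterS => w + cw; apply; split.
Qed.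

(** This is the primitive used along lines in [v]; for bounded [Ov], its continuity across the
    boundary comes from the vanishing boundary values. *)
Lemma continuous_patch_energy x : continuous ((fun v => f x v * dotp v v) \_ Ov).
Proof.
case: hOv => [[_ _ _ bO]|OT]; last first.
  rewrite OT patch_setT => v.
  apply: (@continuousM _ _ (f x) (fun w => dotp w w) v); last exact: continuous_dotp_self.
  by have := @continuous_f_v x v; rewrite OT => /(_ Logic.I).
(* Glue [f x * |v|^2] on [closure Ov] with 0 off [Ov]; they agree on the boundary. *)
apply/continuous_subspace_setT.
rewrite (_ : setT = closure Ov `|` ~` Ov); last first.
  apply/esym/seteqP; split => // v _; have [Ovv|] := pselect (Ov v); last by right.
  by left; exact: subset_closure.
apply: withinU_continuous.
- exact: closed_closure.
- exact: open_closedC.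
- apply: (@subspace_eq_continuous _ _ _ (fun v => f x v * dotp v v)).
    move=> v /set_mem cv; rewrite /from_subspace patchE; case: ifPn => // /negP nv.
    rewrite ((f_vanishing hf).1 bO)// ?mul0r//.
    by move=> Ovv; apply: nv; exact/mem_set.
  move=> v; apply: cvgM; first exact: continuous_within_closure.
  by apply: continuous_subspaceT; exact: continuous_dotp_self.
- apply: (@subspace_eq_continuous _ _ _ (cst 0)); last by move=> v; exact: cvg_cst.
  by move=> v /set_mem nv; rewrite /from_subspace patchE memNset.
Qed.

Lemma integral_grad_x v i : Ov v -> \int[lebesgue_rV d]_(x in box a b) (grad_x f x v 0 i) = 0.
Proof.
move=> Ovv; suff E : (\int[lebesgue_rV d]_(x in box a b) (grad_x f x v 0 i)%:E = 0)%E.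
  by rewrite /Rintegral E.
apply: (@integral_box_pderiv0 _ _ a b i (f^~ v)) => //.
- by move=> x j; have := f_periodic hf x j => ->.
- exact: continuous_grad_x.
- by move=> x; exact: is_derive_grad_x.
Qed.

(** The product rule gives [G] below as a partial derivative of [f * |v|^2], so its integral
    vanishes. The two hypotheses concern a single [x] because integrability on phase space yields
    them only for almost every [x]. *)
Lemma integral_grad_v x i :
  (lebesgue_rV d).-integrable Ov (fun v => (grad_v f x v 0 i * dotp v v)%:E) ->
  (lebesgue_rV d).-integrable Ov (fun v => (f x v * dotp v v)%:E) ->
  \int[lebesgue_rV d]_(v in Ov) (grad_v f x v 0 i * dotp v v) = - 2 * current Ov f x 0 i.
Proof.
move=> iG iF.
have iJ := f_current hf x i.
have iJ2 : (lebesgue_rV d).-integrable Ov (fun v => (2 * (f x v * v 0 i))%:E).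
  by under eq_fun do rewrite EFinM; exact: integrableZl.
pose G v := grad_v f x v 0 i * dotp v v + 2 * (f x v * v 0 i).
have : \int[lebesgue_rV d]_(v in Ov) G v = 0.
  suff E : (\int[lebesgue_rV d]_(v in Ov) (G v)%:E = 0)%E by rewrite /Rintegral E.
  apply: (@integral_pderiv_open0 _ _ i _ ((fun v => f x v * dotp v v) \_ Ov)) => //.
  - by case: hOv => [[]|]; [left|right].
  - exact: continuous_patch_energy.
  - by move=> v nv; rewrite patchE memNset.
  - move=> v Ovv.
    (* Near a point of the open set [Ov] the extension by 0 is the original function, so the
       derivatives agree. *)
    apply: (@near_eq_is_derive _ _ _ (fun v => f x v * dotp v v)).
      near=> w; rewrite patchE mem_set//.
      by near: w; apply: open_nbhs_nbhs.
    have := is_deriveM (is_derive_grad_v x i Ovv) (is_derive_dotp_self v i).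
    by move/is_derive_eq; apply; rewrite /G /GRing.scale/=; ring.
  - move=> v Ovv; apply: (@continuousD _ _ _ (fun w => grad_v f x w 0 i * dotp w w)
      (fun w => 2 * (f x w * w 0 i)) v).
      apply: (@continuousM _ _ (fun w => grad_v f x w 0 i) (fun w => dotp w w) v).
        exact: continuous_grad_v.
      exact: continuous_dotp_self.
    apply: (@continuousM _ _ (cst 2) (fun w => f x w * w 0 i) v); first exact: cst_continuous.
    apply: (@continuousM _ _ (f x) (fun w : 'rV[R]_d => w 0 i) v).
      exact: continuous_f_v.
    exact: coord_continuous.
  - by rewrite -restrict_EFin; exact/(integrable_mkcond _ mOv).1.
  - by apply: eq_integrable (integrableD mOv iG iJ2).
rewrite RintegralD// RintegralZl// => /eqP.
by rewrite addr_eq0 mulNr mxE => /eqP.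
Unshelve. all: by end_near. Qed.

End admissible.

(** * Moments of the transport terms *)

Section phase_space.
Context {R : realType} {d : nat}.
Variables (a b : 'rV[R]_d) (Ov : set 'rV[R]_d).
Hypotheses (hbox : forall i, a 0 i < b 0 i) (hOv : velocity_domain Ov).
Implicit Types (f g : 'rV[R]_d -> 'rV[R]_d -> R) (F : 'rV[R]_d -> 'rV[R]_d).

Let mB : measurable (box a b). Proof. exact: measurable_box. Qed.
Let mO : measurable Ov. Proof. apply: open_measurable_rV; exact: velocity_domain_open. Qed.
Let mBO : measurable (box a b `*` Ov). Proof. exact: measurableX. Qed.

Definition phase_integral g : R :=
  \int[(lebesgue_rV d \x lebesgue_rV d)%E]_(z in box a b `*` Ov) g z.1 z.2.

Lemma kinetic2E f : admissible_f a b Ov f ->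
  kinetic2 a b Ov f = phase_integral (fun x v => f x v * dotp v v).
Proof. move=> hf; exact: (Rintegral12_rectangle mB mO (f_energy hf)). Qed.

(** With [x] integrated first, [v] is fixed and the weight [v_i |v|^2] is a constant factor;
    periodicity then kills each component. *)
Lemma phase_transport_x0 f : admissible_f a b Ov f ->
  phase_integral (fun x v => dotp v (grad_x f x v) * dotp v v) = 0.
Proof.
move=> hf; rewrite /phase_integral -(Rintegral21_rectangle mB mO (f_grad_x hf)).
transitivity (\int[lebesgue_rV d]_(v in Ov) (cst 0 v : R)); last first.
  by rewrite /Rintegral integral0.
apply: eq_Rintegral => v /set_mem Ovv /=.
have ig i : (lebesgue_rV d).-integrable (box a b) (EFin \o (fun x => grad_x f x v 0 i)).
  exact/continuous_box_integrable/(continuous_grad_x hf).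
have igv i : (lebesgue_rV d).-integrable (box a b)
    (EFin \o (fun x => (v 0 i * dotp v v) * grad_x f x v 0 i)).
  by apply: eq_integrable (integrableZl mB (v 0 i * dotp v v) (ig i)).
transitivity (\int[lebesgue_rV d]_(x in box a b)
    \sum_(i < d) ((v 0 i * dotp v v) * grad_x f x v 0 i)).
  by apply: eq_Rintegral => x _; rewrite mulr_suml; apply: eq_bigr => i _; ring.
rewrite Rintegral_sum// big1// => i _.
by rewrite RintegralZl// (integral_grad_x hbox hf i Ovv) mulr0.
Qed.

(** [F] is a continuous function of [x] alone, so it is bounded on the box and comes out of the
    integral over [v], which integration by parts turns into the current. *)
Lemma phase_transport_v f F : admissible_f a b Ov f -> continuous F ->
  [/\ phase_integrable a b Ov (fun x v => dotp (F x) (grad_v f x v) * dotp v v),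
      (lebesgue_rV d).-integrable (box a b)
        (fun x => (dotp (F x) (current Ov f x))%:E)
    & phase_integral (fun x v => dotp (F x) (grad_v f x v) * dotp v v)
      = - 2 * \int[lebesgue_rV d]_(x in box a b) dotp (F x) (current Ov f x)].
Proof.
move=> hf cF.
have cFi i : continuous (fun x => F x 0 i).
  by move=> x; apply: (@continuous_comp _ _ _ F (fun u : 'rV[R]_d => u 0 i));
    [exact: cF|exact: coord_continuous].
have /choice[M FM] i := continuous_box_bounded a b (cFi i).
pose G i (z : 'rV[R]_d * 'rV[R]_d) := F z.1 0 i * (grad_v f z.1 z.2 0 i * dotp z.2 z.2).
have iG i : (lebesgue_rV d \x lebesgue_rV d)%E.-integrable (box a b `*` Ov) (EFin \o G i).
  apply: (@integrable_bounded_mul _ _ _ _ _ _ (fun z => F z.1 0 i) _ (M i)) => //.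
  - apply: measurable_funTS; exact: measurableT_comp (continuous_measurable_rV (cFi i)) measurable_fst.
  - by move=> z [/FM].
  - exact: f_grad_v hf i.
have GE x v : dotp (F x) (grad_v f x v) * dotp v v = \sum_(i < d) G i (x, v).
  by rewrite mulr_suml; apply: eq_bigr => i _; rewrite /G mulrA.
have iJ i : (lebesgue_rV d).-integrable (box a b) (EFin \o (fun x => current Ov f x 0 i)).
  have := integrable_Rintegral_rectangle mB mO (f_momentum hf i).
  by apply: eq_integrable => // x _ /=; rewrite mxE.
have iFJ i : (lebesgue_rV d).-integrable (box a b)
    (EFin \o (fun x => F x 0 i * current Ov f x 0 i)).
  apply: (integrable_bounded_mul (M := M i) mB _ _ (iJ i)).
  - apply: measurable_funTS; exact: continuous_measurable_rV.
  - by move=> x /FM.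
split.
- have := integrable_fin_sum mBO (index_enum 'I_d) iG.
  by apply: eq_integrable => // z _; rewrite GE; case: z.
- have := integrable_fin_sum mB (index_enum 'I_d) iFJ.
  by apply: eq_integrable.
transitivity (\sum_(i < d) \int[(lebesgue_rV d \x lebesgue_rV d)%E]_(z in box a b `*` Ov) G i z).
  rewrite -Rintegral_sum//; apply: eq_Rintegral => -[x v] _; exact: GE.
rewrite Rintegral_sum// mulr_sumr; apply: eq_bigr => i _.
rewrite -RintegralZl//.
rewrite -(Rintegral12_rectangle (g := fun x v => G i (x, v)) mB mO); last first.
  by apply: eq_integrable (iG i) => // -[].
apply: ae_eq_Rintegral => //.
- apply: (integrable_Rintegral_rectangle (g := fun x v => G i (x, v)) mB mO).
  by apply: eq_integrable (iG i) => // -[].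
- by apply: eq_integrable (integrableZl mB (- 2) (iFJ i)).
(* Integration by parts needs integrable slices, which Fubini's theorem provides for almost every
   [x]. *)
have := ae_integrable_rectangle mB mO (f_grad_v hf i).
have := ae_integrable_rectangle mB mO (f_energy hf).
apply: filterS2 => x + + Bx => /(_ Bx) ie /(_ Bx) ig.
by rewrite /G /= RintegralZl// (integral_grad_v hOv hf ig ie); ring.
Qed.

End phase_space.

(** * Energy balance *)

Section energy_balance.
Context {R : realType} {d : nat}.
Variables (a b : 'rV[R]_d) (Ov : set 'rV[R]_d).
Hypotheses (hbox : forall i, a 0 i < b 0 i) (hOv : velocity_domain Ov).
Implicit Types (f g : 'rV[R]_d -> 'rV[R]_d -> R) (F : 'rV[R]_d -> 'rV[R]_d).

Lemma grad_x_favg f g x v : admissible_f a b Ov f -> admissible_f a b Ov g ->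
  Ov v -> grad_x (favg f g) x v = 2^-1 *: (grad_x f x v + grad_x g x v).
Proof.
move=> hf hg Ovv; apply/rowP => i; rewrite !mxE.
have df := is_derive_grad_x hf x i Ovv; have dg := is_derive_grad_x hg x i Ovv.
have := is_deriveM (is_deriveD df dg) (is_derive_cst (2^-1 : R) x (delta_mx 0 i)).
move=> [_ E]; rewrite !mxE in E.
by rewrite -[LHS]/('D_(delta_mx 0 i) (((f^~ v) + (g^~ v)) * cst 2^-1) x) E scaler0 add0r.
Qed.

Lemma grad_v_favg f g x v : admissible_f a b Ov f -> admissible_f a b Ov g ->
  Ov v -> grad_v (favg f g) x v = 2^-1 *: (grad_v f x v + grad_v g x v).
Proof.
move=> hf hg Ovv; apply/rowP => i; rewrite !mxE.
have df := is_derive_grad_v hf x i Ovv; have dg := is_derive_grad_v hg x i Ovv.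
have := is_deriveM (is_deriveD df dg) (is_derive_cst (2^-1 : R) v (delta_mx 0 i)).
move=> [_ E]; rewrite !mxE in E.
by rewrite -[LHS]/('D_(delta_mx 0 i) ((f x + g x) * cst 2^-1) v) E scaler0 add0r.
Qed.

Lemma dotpDr (u v w : 'rV[R]_d) : dotp u (v + w) = dotp u v + dotp u w.
Proof. by rewrite /dotp -big_split; apply: eq_bigr => i _; rewrite mxE mulrDr. Qed.

Lemma dotpZr k (u v : 'rV[R]_d) : dotp u (k *: v) = k * dotp u v.
Proof. by rewrite /dotp mulr_sumr; apply: eq_bigr => i _; rewrite mxE mulrCA. Qed.

(** The Vlasov step at one point, solved for the new density and multiplied by a weight [w], later
    [|v|^2]. The [p] are transport terms, the [q] are field terms. *)
Lemma step_moment (dt y0 y1 p0 p1 q0 q1 w : R) : dt != 0 ->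
  (y1 - y0) / dt + 2^-1 * (p0 + p1) + 2^-1 * (q0 + q1) = 0 ->
  y1 * w = y0 * w - dt / 2 * ((p0 * w + p1 * w) + (q0 * w + q1 * w)).
Proof.
move=> dt0 e; have -> : y1 = y0 + dt * ((y1 - y0) / dt) by field.
have -> : (y1 - y0) / dt = - (2^-1 * (p0 + p1)) - 2^-1 * (q0 + q1) by lra.
by field.
Qed.

(* [f0], [f1] are consecutive densities; in the schemes [g0], [g1] are either
   [f0], [f1] (implicit) or both the half-step density (explicit). *)
Lemma kinetic2_step (dt : R) f0 f1 g0 g1 F : dt != 0 ->
  admissible_f a b Ov f0 -> admissible_f a b Ov f1 ->
  admissible_f a b Ov g0 -> admissible_f a b Ov g1 -> continuous F ->
  (forall x v, Ov v ->
     (f1 x v - f0 x v) / dt + dotp v (grad_x (favg g0 g1) x v)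
       + dotp (F x) (grad_v (favg g0 g1) x v) = 0) ->
  kinetic2 a b Ov f1 = kinetic2 a b Ov f0
    + dt * \int[lebesgue_rV d]_(x in box a b)
        (dotp (F x) (current Ov g0 x) + dotp (F x) (current Ov g1 x)).
Proof.
move=> dt0 hf0 hf1 hg0 hg1 cF step.
have mB : measurable (box a b) by exact: measurable_box.
have mO : measurable Ov by apply: open_measurable_rV; exact: velocity_domain_open.
have mBO : measurable (box a b `*` Ov) by exact: measurableX.
have [iv0 iJ0 v0] := phase_transport_v hOv hg0 cF.
have [iv1 iJ1 v1] := phase_transport_v hOv hg1 cF.
have x0 := phase_transport_x0 hbox hOv hg0.
have x1 := phase_transport_x0 hbox hOv hg1.
have ix0 := f_grad_x hg0; have ix1 := f_grad_x hg1.
have ik := f_energy hf0.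
rewrite RintegralD// !kinetic2E// /phase_integral.
set m := (_ \x _)%E in iv0 iv1 ix0 ix1 ik v0 v1 x0 x1 *.
pose D := box a b `*` Ov.
pose K z := f0 z.1 z.2 * dotp z.2 z.2.
pose X0 z := dotp z.2 (grad_x g0 z.1 z.2) * dotp z.2 z.2.
pose X1 z := dotp z.2 (grad_x g1 z.1 z.2) * dotp z.2 z.2.
pose V0 z := dotp (F z.1) (grad_v g0 z.1 z.2) * dotp z.2 z.2.
pose V1 z := dotp (F z.1) (grad_v g1 z.1 z.2) * dotp z.2 z.2.
have iK : m.-integrable D (EFin \o K) := ik.
have iX0 : m.-integrable D (EFin \o X0) := ix0.
have iX1 : m.-integrable D (EFin \o X1) := ix1.
have iV0 : m.-integrable D (EFin \o V0) := iv0.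
have iV1 : m.-integrable D (EFin \o V1) := iv1.
have iX : m.-integrable D (EFin \o (fun z => X0 z + X1 z)) := integrableD mBO iX0 iX1.
have iV : m.-integrable D (EFin \o (fun z => V0 z + V1 z)) := integrableD mBO iV0 iV1.
have iS : m.-integrable D (EFin \o (fun z => (X0 z + X1 z) + (V0 z + V1 z))) :=
  integrableD mBO iX iV.
have {x0}X00 : \int[m]_(z in D) X0 z = 0 := x0.
have {x1}X10 : \int[m]_(z in D) X1 z = 0 := x1.
have {v0}V0E : \int[m]_(z in D) V0 z = _ := v0.
have {v1}V1E : \int[m]_(z in D) V1 z = _ := v1.
(* Pointwise on [D], the new kinetic density is the old one minus the weighted transport and field
   terms. *)
transitivity (\int[m]_(z in D) (K z - dt / 2 * ((X0 z + X1 z) + (V0 z + V1 z)))).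
  apply: eq_Rintegral => -[x v] /set_mem[/= _ Ovv].
  have := step x v Ovv; rewrite grad_x_favg// grad_v_favg// !dotpZr !dotpDr => e.
  exact: step_moment dt0 e.
have XE := RintegralD mBO iX0 iX1; rewrite X00 X10 addr0 in XE.
have VE := RintegralD mBO iV0 iV1; rewrite V0E V1E in VE.
have SE := RintegralD mBO iX iV; rewrite XE VE add0r in SE.
rewrite (RintegralB mBO iK); last by apply: eq_integrable (integrableZl mBO (dt / 2) iS).
rewrite (RintegralZl (dt / 2) mBO iS) SE.
(* The factor [-2] from integration by parts turns [- dt / 2] into [dt]. *)
have alg (k p q : R) : k - dt / 2 * (- 2 * p + - 2 * q) = k + dt * (p + q) by field.
exact: alg.
Qed.

End energy_balance.

(** * Algebra of the field updates *)

Lemma scaled_increment {R : realType} {d : nat} (k : R) (u w j : 'rV[R]_d) : k != 0 ->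
  k^-1 *: (u - w) = - j -> u = w - k *: j.
Proof. by move=> k0 e; rewrite -scalerN -e scalerA mulfV// scale1r addrC subrK. Qed.

(** [|u|^2 - |w|^2 = (u + w) . (u - w)]: pairing the currents with the midpoint field makes the loss
    of field energy match the kinetic gain exactly. *)
Lemma dotp_midpoint_increment {R : realType} {d : nat} (k : R) (u w j0 j1 : 'rV[R]_d) :
  u = w - k *: (2^-1 *: (j0 + j1)) ->
  dotp u u = dotp w w - k * (dotp (2^-1 *: (w + u)) j0 + dotp (2^-1 *: (w + u)) j1).
Proof.
move=> ->; rewrite -dotpDr /dotp mulr_sumr -sumrB; apply: eq_bigr => i _.
by rewrite !mxE; field.
Qed.

(** [p . h - h . m = h . (p - m)]. With [m], [h], [p] the fields at three successive half-integer
    times, this is the balance of the staggered field energy. *)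
Lemma dotp_leapfrog_increment {R : realType} {d : nat} (k : R) (p h m j0 j1 : 'rV[R]_d) :
  m = h + k *: j0 -> p = h - k *: j1 ->
  dotp p h = dotp h m - k * (dotp h j0 + dotp h j1).
Proof.
move=> -> ->; rewrite -dotpDr /dotp mulr_sumr -sumrB; apply: eq_bigr => i _.
by rewrite !mxE; ring.
Qed.

Lemma Rintegral_increment d (T : measurableType d) (R : realType)
    (mu : {measure set T -> \bar R}) (D : set T) (c : R) (h0 h1 k : T -> R) :
  measurable D -> mu.-integrable D (EFin \o h0) -> mu.-integrable D (EFin \o k) ->
  (forall x, h1 x = h0 x - c * k x) ->
  \int[mu]_(x in D) h1 x = \int[mu]_(x in D) h0 x - c * \int[mu]_(x in D) k x.
Proof.
move=> mD i0 ik e; rewrite -RintegralZl// -RintegralB//.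
  by apply: eq_Rintegral => x _; exact: e.
by apply: eq_integrable (integrableZl mD c ik).
Qed.

(** Puts the explicit scheme into the averaged form of [kinetic2_step]. *)
Lemma favg_id {R : realType} {d : nat} (f : 'rV[R]_d -> 'rV[R]_d -> R) : favg f f = f.
Proof. by apply/funext => x; apply/funext => v; rewrite /favg; field. Qed.

Unset Implicit Arguments.

Theorem theorem3p1 (R : realType) (d : nat) (a b : 'rV[R]_d)
    (Ov : set 'rV[R]_d) (dt : R)
    (f : nat -> 'rV[R]_d -> 'rV[R]_d -> R) (E : nat -> 'rV[R]_d -> 'rV[R]_d)
    (hbox : forall i, a 0 i < b 0 i)
    (hOv : velocity_domain Ov)
    (hdt : 0 < dt)
    (hf : forall n, admissible_f a b Ov (f n))
    (hE : forall n, admissible_E a b (E n)) :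
  [/\ forall fh : nat -> 'rV[R]_d -> 'rV[R]_d -> R,
        (forall n, admissible_f a b Ov (fh n)) ->
        (forall n, scheme1 dt Ov (f n) (E n) (fh n) (f n.+1) (E n.+1)) ->
        forall n, TE a b Ov (f n) (E n) = TE a b Ov (f n.+1) (E n.+1),
      (forall n, scheme2 dt Ov (f n) (E n) (f n.+1) (E n.+1)) ->
        forall n, TE a b Ov (f n) (E n) = TE a b Ov (f n.+1) (E n.+1)
    & forall Eh : nat -> 'rV[R]_d -> 'rV[R]_d,
        (forall n, admissible_E a b (Eh n)) ->
        (forall n, scheme3 dt Ov (f n) (E n) (Eh n) (f n.+1) (E n.+1)) ->
        let Em := Ehalf_prev dt Ov (f 0%N) (E 0%N) Eh in
        forall n,
          TE3 a b Ov (f n) (Eh n) (Em n)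
            = TE3 a b Ov (f n.+1) (Eh n.+1) (Em n.+1) /\
          2 * TE3 a b Ov (f n) (Eh n) (Em n)
            = kinetic2 a b Ov (f n)
              + \int[lebesgue_rV d]_(x in box a b) dotp (E n x) (E n x)
              - dt ^+ 2 / 4 * \int[lebesgue_rV d]_(x in box a b)
                  dotp (current Ov (f n) x) (current Ov (f n) x)].
Proof.
have mB : measurable (box a b) := measurable_box a b.
have dt0 : dt != 0 by rewrite gt_eqF.
have dt20 : dt / 2 != 0 by rewrite gt_eqF// divr_gt0.
have cE n : continuous (E n) := (hE n).2.
have iDD (F G : 'rV[R]_d -> 'rV[R]_d) : continuous F -> continuous G ->
    (lebesgue_rV d).-integrable (box a b) (EFin \o (fun x => dotp (F x) (G x))).
  by move=> cF cG; apply: continuous_box_integrable; exact: continuous_dotp.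
have iJJ F g0 g1 : continuous F -> admissible_f a b Ov g0 -> admissible_f a b Ov g1 ->
    (lebesgue_rV d).-integrable (box a b)
      (EFin \o (fun x => dotp (F x) (current Ov g0 x) + dotp (F x) (current Ov g1 x))).
  move=> cF hg0 hg1; have [_ i0 _] := phase_transport_v hOv hg0 cF.
  by have [_ i1 _] := phase_transport_v hOv hg1 cF; exact: (integrableD mB i0 i1).
have cavg n : continuous (Eavg (E n) (E n.+1)).
  move=> x; apply: (@continuousZr _ _ _ (E n \+ E n.+1) 2^-1 x).
  by apply: continuousD; exact: cE.
split.
(* Explicit scheme: the half-step density drives both updates, so the kinetic balance is used with
   two copies of it. *)
- move=> fh hfh S n; have [_ S2 S3] := S n.
  have K := kinetic2_step hbox hOv dt0 (hf n) (hf n.+1) (hfh n) (hfh n) (cavg n).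
  rewrite favg_id in K; have {}K := K S3.
  rewrite /TE K; congr (_ * _); rewrite -addrA; congr (_ + _).
  rewrite (Rintegral_increment (c := dt) (h1 := fun x => dotp (E n.+1 x) (E n.+1 x))
    mB (iDD _ _ (cE n) (cE n)) (iJJ _ _ _ (cavg n) (hfh n) (hfh n))).
    by rewrite [RHS]addrC subrK.
  move=> x; apply: dotp_midpoint_increment.
  (* The half-step current is seen as the mean of two copies of itself. *)
  rewrite (scaled_increment dt0 (S2 x)); congr (_ - _ *: _).
  by apply/rowP => i; rewrite !mxE; field.
(* Implicit midpoint: the field update already has the averaged form of
   [dotp_midpoint_increment]. *)
- move=> S n; have [S1 S2] := S n.
  have K := kinetic2_step hbox hOv dt0 (hf n) (hf n.+1) (hf n) (hf n.+1) (cavg n) S1.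
  rewrite /TE K; congr (_ * _); rewrite -addrA; congr (_ + _).
  rewrite (Rintegral_increment (c := dt) (h1 := fun x => dotp (E n.+1 x) (E n.+1 x))
    mB (iDD _ _ (cE n) (cE n)) (iJJ _ _ _ (cavg n) (hf n) (hf n.+1))).
    by rewrite [RHS]addrC subrK.
  by move=> x; apply: dotp_midpoint_increment; exact: scaled_increment (S2 x).
- move=> Eh hEh S Em n.
  have cEh m : continuous (Eh m) := (hEh m).2.
  have EhE m x : Eh m x = E m x - (dt / 2) *: current Ov (f m) x.
    by have [S1 _ _] := S m; exact: scaled_increment (S1 x).
  have ESE m x : E m.+1 x = Eh m x - (dt / 2) *: current Ov (f m.+1) x.
    by have [_ _ S3] := S m; exact: scaled_increment (S3 x).
  (* For [m = 0] this is the definition of the field at time [-1/2]; afterwards it is the last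
     substep of the preceding step, solved backwards. *)
  have EmE m x : Em m x = E m x + (dt / 2) *: current Ov (f m) x.
    by case: m => [//|m] /=; rewrite ESE subrK.
  (* [Em n] is the reflection of [Eh n] about [E n], so its continuity follows from that of the two
     fields. *)
  have cEm : continuous (Em n).
    rewrite (_ : Em n = fun x => E n x + (E n x - Eh n x)).
      move=> x; apply: (@continuousD _ _ _ (E n) (E n \- Eh n) x); first exact: cE.
      by apply: continuousB; [exact: cE|exact: cEh].
    by apply/funext => x; rewrite EmE EhE; congr (_ + _); rewrite opprB addrC subrK.
  have iEE := iDD _ _ (cE n) (cE n).
  split.
    have [_ S2 _] := S n.
    have K := kinetic2_step hbox hOv dt0 (hf n) (hf n.+1) (hf n) (hf n.+1) (cEh n) S2.
    rewrite /TE3 K; congr (_ * _); rewrite -addrA; congr (_ + _).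
    rewrite (Rintegral_increment (c := dt) (h1 := fun x => dotp (Eh n.+1 x) (Em n.+1 x))
      mB (iDD _ _ (cEh n) cEm) (iJJ _ _ _ (cEh n) (hf n) (hf n.+1))).
      by rewrite [RHS]addrC subrK.
    (* The staggered products at consecutive steps share the factor [Eh n]; eliminating [E n] and
       [E n.+1] gives full steps between half-integer times. *)
    move=> x; rewrite -[Em n.+1 x]/(Eh n x); apply: dotp_leapfrog_increment.
      by rewrite EmE EhE; apply/rowP => i; rewrite !mxE; field.
    by rewrite EhE ESE; apply/rowP => i; rewrite !mxE; field.
  rewrite /TE3 mulrA mulfV// mul1r -addrA; congr (_ + _).
  apply: Rintegral_increment => //.
    (* Solving the first substep for the current shows that it is continuous, so its square is
       integrable over the box. *)
    pose J x := (dt / 2)^-1 *: (E n x - Eh n x).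
    have cJ : continuous J.
      move=> x; apply: (@continuousZr _ _ _ (E n \- Eh n) (dt / 2)^-1 x).
      by apply: continuousB; [exact: cE|exact: cEh].
    rewrite (_ : current Ov (f n) = J); first exact: iDD.
    by apply/funext => x; rewrite /J EhE opprB addrC subrK scalerA mulVf// scale1r.
  (* A difference of squares, [(E - k J) . (E + k J)] with [k = dt / 2], produces the constant
     [dt ^+ 2 / 4]. *)
  move=> x; rewrite EhE EmE /dotp mulr_sumr -sumrB; apply: eq_bigr => i _.
  by rewrite !mxE; field.
Qed.
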